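(* Let $\mathfrak{X}$ be a Banach space that fails the complete continuity property and fails cotype. Then $\mathfrak{X}$ has a closed subspace with a (Schauder) basis that fails the complete continuity property.
   Context: Scalars are real. $L_1$ is the space $L_1[0,1]$ with respect to Lebesgue measure. A bounded linear operator is completely continuous if it maps weakly convergent sequences to norm convergent sequences. A Banach space $\mathfrak{X}$ has the complete continuity property (CCP) if each bounded linear operator from $L_1$ into $\mathfrak{X}$ is completely continuous. A Banach space $\mathfrak{X}$ fails cotype if it contains $\ell_\infty^n$ uniformly for all $n$, i.e. there is a constant $C$ such that for every $n$ there is an $n$-dimensional subspace of $\mathfrak{X}$ that is $C$-isomorphic to $\ell_\infty^n$. *)

(* Defs.v *)
From HB Require Import structures.
From mathcomp Require Import all_boot all_order all_algebra generic_quotient.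
From mathcomp Require Import all_classical all_reals all_analysis measurable_realfun.

Set Implicit Arguments.
Unset Strict Implicit.
Unset Printing Implicit Defensive.
Import Order.TTheory GRing.Theory Num.Theory.
Import numFieldNormedType.Exports.
Local Open Scope classical_set_scope.
Local Open Scope ring_scope.

(* MathComp-Analysis provides [LspaceType1 mu], the a.e.-classes of integrable
   functions, only as a bare type.  It is equipped here with the vector space
   operations induced by those on functions and with the norm
   f |-> \int |f| dmu, see [L1_classE] and [L1_normE]. *)
Section L1_normed.
Context d (T : measurableType d) (R : realType).
Variable mu : {measure set T -> \bar R}.

Local Notation L1 := (LspaceType1 mu).
Local Notation p1 := (@lexx _ _ (1%E : \bar R)).
Local Notation Lf := (LfunType mu p1).

HB.instance Definition _ := gen_eqMixin L1.
HB.instance Definition _ := gen_choiceMixin L1.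

Lemma L1_ae_eq (f g : L1) : (f : T -> R) = g %[ae mu] -> f = g.
Proof.
case: f => f [[Pf]]; case: g => g [[Pg]] /= fg.
have fge : f = g.
  have /eqP := introT (ae_eqP f g) fg.
  by rewrite !reprK.
by subst g; rewrite (Prop_irrelevance Pf Pg).
Qed.

Let measurable_abs_EFin (f : T -> R) : measurable_fun setT f ->
  measurable_fun setT (fun x => `|(EFin \o f) x|%E).
Proof.
move=> mf; apply: (@measurableT_comp _ _ _ _ _ _ (@abse R) _ (EFin \o f)) => //.
exact/measurable_EFinP.
Qed.

Lemma Lnorm1_ae (f g : Lf) : (f : T -> R) = g %[ae mu] ->
  ('N[mu]_1[EFin \o f] = 'N[mu]_1[EFin \o g])%E.
Proof.
move=> fg; rewrite !Lnorm1; apply: ae_eq_integral => //.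
- exact: measurable_abs_EFin.
- exact: measurable_abs_EFin.
- by apply: filterS fg => x /= /[apply] ->.
Qed.

Lemma L1_Lfun (f : L1) : (f : T -> R) \in Lfun mu 1%E.
Proof.
rewrite inE; apply/andP; split; rewrite inE/=.
- exact: (@measurable_funPT _ _ _ (measurableTypeR R) (repr (f : {mfun_ mu, T >-> measurableTypeR R}))).
- exact: Lebesgue_finite.
Qed.

(* [L1_repr] chooses a representative of a class, [L1_class] is the projection
   onto classes. *)
Definition L1_repr (f : L1) : Lf := Lfun_Sub p1 (L1_Lfun f).

Let mfunR (f : Lf) : {mfun T >-> measurableTypeR R} :=
  HB.pack (f : T -> measurableTypeR R)
    (@isMeasurableFun.Build _ _ T (measurableTypeR R) f
       (@measurable_funPT _ _ T R f)).

Let pi_L1 (f : Lf) : {mfun_ mu, T >-> measurableTypeR R} := (\pi_({mfun_ mu, T >-> measurableTypeR R}) (mfunR f))%qT.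

Let pi_L1_ae (f : Lf) : (pi_L1 f : T -> R) = f %[ae mu].
Proof.
have := reprK (pi_L1 f); rewrite [RHS]/pi_L1 => /eqP.
by rewrite eqmodE => /asboolP.
Qed.

Let pi_L1_fin (f : Lf) : finite_norm mu 1%E (pi_L1 f : T -> R).
Proof.
rewrite /finite_norm.
have -> : ('N[mu]_1[EFin \o pi_L1 f] = 'N[mu]_1[EFin \o f])%E.
  rewrite !Lnorm1; apply: ae_eq_integral => //.
  - apply: measurable_abs_EFin.
    exact: (@measurable_funPT _ _ _ (measurableTypeR R) (repr (pi_L1 f))).
  - exact: measurable_abs_EFin.
  - by apply: filterS (pi_L1_ae f) => x /= /[apply] ->.
exact: Lfunction_finite.
Qed.

Definition L1_class (f : Lf) : L1 :=
  HB.pack (pi_L1 f) (isFinLebesgue.Build d T R mu 1%E p1 _ (pi_L1_fin f)).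

Lemma L1_classE (f : Lf) : (L1_class f : T -> R) = f %[ae mu].
Proof. exact: pi_L1_ae. Qed.

Lemma L1_class_eq (f g : Lf) : (f : T -> R) = g %[ae mu] ->
  L1_class f = L1_class g.
Proof.
move=> fg; apply: L1_ae_eq.
apply: ae_eq_trans (L1_classE f) _; apply: ae_eq_trans fg _.
exact/ae_eq_sym/L1_classE.
Qed.

Lemma L1_reprK : cancel L1_repr L1_class.
Proof. by move=> f; apply: L1_ae_eq; exact: L1_classE. Qed.

Lemma L1_classK (f : Lf) : (L1_repr (L1_class f) : T -> R) = f %[ae mu].
Proof. exact: L1_classE. Qed.

Let add (f g : L1) := L1_class (L1_repr f + L1_repr g).
Let opp (f : L1) := L1_class (- L1_repr f).
Let scale (a : R) (f : L1) := L1_class (a *: L1_repr f).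

Let L1_classD f g : L1_class (f + g) = add (L1_class f) (L1_class g).
Proof.
apply: L1_class_eq.
apply: filterS2 (L1_classK f) (L1_classK g) => x /= + + I => /(_ I) fx /(_ I) gx.
by rewrite [LHS]/(f x + g x) -fx -gx.
Qed.

Let L1_classN f : L1_class (- f) = opp (L1_class f).
Proof.
apply: L1_class_eq; apply: filterS (L1_classK f) => x /= + I => /(_ I) fx.
by rewrite [LHS]/(- f x) -fx.
Qed.

Let L1_classZ a f : L1_class (a *: f) = scale a (L1_class f).
Proof.
apply: L1_class_eq; apply: filterS (L1_classK f) => x /= + I => /(_ I) fx.
by rewrite [LHS]/(a * f x) -fx.
Qed.

Let addA : associative add.
Proof.
move=> f g h; rewrite -[f]L1_reprK -[g]L1_reprK -[h]L1_reprK.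
by rewrite -!L1_classD addrA.
Qed.

Let addC : commutative add.
Proof. by move=> f g; rewrite /add addrC. Qed.

Let add0 : left_id (L1_class 0) add.
Proof. by move=> f; rewrite -[f]L1_reprK -L1_classD add0r. Qed.

Let addN : left_inverse (L1_class 0) opp add.
Proof. by move=> f; rewrite -[f]L1_reprK -L1_classN -L1_classD addNr. Qed.

HB.instance Definition _ := GRing.isZmodule.Build L1 addA addC add0 addN.

Let addE (f g : L1) : f + g = add f g. Proof. by []. Qed.

Let scaleA a b f : scale a (scale b f) = scale (a * b) f.
Proof. by rewrite -[f]L1_reprK -!L1_classZ scalerA. Qed.

Let scale1 : left_id 1 scale.
Proof. by move=> f; rewrite /scale scale1r L1_reprK. Qed.

Let scaleDr : right_distributive scale +%R.
Proof.
move=> a f g; rewrite -[f]L1_reprK -[g]L1_reprK.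
by rewrite !addE -L1_classD -!L1_classZ scalerDr L1_classD.
Qed.

Let scaleDl f : {morph scale^~ f : a b / a + b}.
Proof.
by move=> a b; rewrite -[f]L1_reprK -!L1_classZ scalerDl addE -L1_classD.
Qed.

HB.instance Definition _ := GRing.Zmodule_isLmodule.Build R L1
  scaleA scale1 scaleDr scaleDl.

Let norm (f : L1) : R := fine ('N[mu]_1[EFin \o f])%E.

Let norm_class f : norm (L1_class f) = fine ('N[mu]_1[EFin \o f])%E.
Proof. by rewrite /norm -(Lnorm1_ae (L1_classK f)). Qed.

Let ler_normD f g : norm (f + g) <= norm f + norm g.
Proof.
rewrite -[f]L1_reprK -[g]L1_reprK addE -L1_classD !norm_class.
exact: ler_LnormD.
Qed.

Let normZ a f : norm (a *: f) = `|a| * norm f.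
Proof.
rewrite -[f]L1_reprK.
rewrite -[a *: L1_class _]/(scale a (L1_class _)) -L1_classZ !norm_class.
by rewrite LnormZ fineM// -finite_norm_fine.
Qed.

Let norm_eq0 f : norm f = 0 -> f = 0.
Proof.
have := @fine_Lnormr_eq0 _ _ _ mu _ p1 (L1_repr f) => + nf0; move=> /(_ nf0) f0.
rewrite -[LHS]L1_reprK; apply: (L1_class_eq (g := 0)); exact: f0.
Qed.

HB.instance Definition _ := Lmodule_isNormed.Build R L1 ler_normD normZ norm_eq0.

Lemma L1_normE (f : L1) : (`|f|%:E = \int[mu]_x `|(f x)%:E|)%E.
Proof. by rewrite -Lnorm1; exact: (finite_norm_fine (L1_repr f)). Qed.

End L1_normed.


(* Functions live on the whole line, but the measure A |-> lambda(A `&` [0, 1])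
   is carried by [0, 1], so the a.e.-classes are those of L_1[0, 1]. *)
Definition L1_01 (R : realType) : normedModType R :=
  LspaceType1 (mrestr (@lebesgue_measure R) (measurable_itv `[0%R, 1%R])).

Section subspaces.
Context (R : realType) (X : normedModType R).

(* A linear subspace with the norm inherited from the ambient space. *)
Definition linsub (S : submodClosed X) : Type := {x : X | x \in S}.

Variable S : submodClosed X.

HB.instance Definition _ := SubChoice.on (linsub S).
HB.instance Definition _ := [SubChoice_isSubLmodule of linsub S by <:].

Let norm (x : linsub S) : R := `|val x|.

Let ler_normD x y : norm (x + y) <= norm x + norm y.
Proof. exact: ler_normD. Qed.

Let normZ a x : norm (a *: x) = `|a| * norm x.
Proof. exact: normrZ. Qed.

Let norm_eq0 x : norm x = 0 -> x = 0.
Proof. by move=> /normr0_eq0 x0; exact: val_inj. Qed.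

HB.instance Definition _ :=
  Lmodule_isNormed.Build R (linsub S) ler_normD normZ norm_eq0.

Lemma linsub_normE (x : linsub S) : `|x| = `|val x|. Proof. by []. Qed.

End subspaces.

(* Closed subspaces of Banach spaces are Banach spaces. *)
Lemma closed_linsub_complete (R : realType) (X : completeNormedModType R)
    (S : submodClosed X) : closed [set` S] ->
  forall F : set_system (linsub S), ProperFilter F -> cauchy F -> cvg F.
Proof.
move=> cS F FF /cauchyP Fc.
have vF : cauchy (val @ F).
  apply/cauchyP => e e0; have [x Fx] := Fc e e0; exists (val x).
  apply: filterS Fx => y; rewrite -!ball_normE/= => xy.
  exact: xy.
have /cvg_ex[l Fl] : cvg (val @ F) by exact: cauchy_cvg.
have Sl : l \in S.
  apply: (closed_cvg (fun x : X => x \in S)) Fl => //.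
  by apply: filterE => x; exact: valP.
apply/cvg_ex; exists (Sub l Sl : linsub S).
apply/cvgrPdist_lt => e e0.
by move/cvgrPdist_lt : Fl => /(_ e e0).
Qed.

Section operators.
Context (R : realType).
Implicit Types V W : normedModType R.

Definition weakly_cvg V (u : nat -> V) (l : V) : Prop :=
  forall f : {linear V -> R^o}, bounded_fun_norm f -> f \o u @ \oo --> f l.

Definition completely_continuous V W (T : V -> W) : Prop :=
  forall (u : nat -> V) (l : V), weakly_cvg u l -> cvgn (T \o u).

(* [bounded_fun_norm]: bounded on bounded sets, i.e. a bounded operator. *)
Definition CCP V : Prop :=
  forall T : {linear L1_01 R -> V},
    bounded_fun_norm T -> completely_continuous T.

(* There is an isomorphism J with ||J|| * ||J^-1|| <= C. *)
Definition C_isomorphic (C : R) V W : Prop :=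
  exists (J : {linear V -> W}) (K : {linear W -> V}) (a b : R),
    [/\ cancel J K, cancel K J,
        forall x, `|J x| <= a * `|x|, forall y, `|K y| <= b * `|y|
      & a * b <= C].

(* The library norm of 'rV[R]_n is the maximum norm, so 'rV[R]_n is
   l_infty^n; an E isomorphic to it has dimension n. *)
Definition fails_cotype V : Prop :=
  exists C : R, forall n : nat,
    exists E : submodClosed V, C_isomorphic C 'rV[R]_n (linsub E).

Definition schauder_basis V (e : nat -> V) : Prop :=
  forall x : V, exists! a : nat -> R,
    series (fun n => a n *: e n) @ \oo --> x.

End operators.

(* Main.v *)
From HB Require Import structures.
From mathcomp Require Import all_boot all_order all_algebra.
From mathcomp Require Import all_classical all_reals all_analysis.
From mathcomp Require Import measurable_realfun ring lra zify.
Require Import Defs.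
Set Implicit Arguments.
Unset Strict Implicit.
Unset Printing Implicit Defensive.
Import Order.TTheory GRing.Theory Num.Theory.
Import numFieldNormedType.Exports.
Local Open Scope classical_set_scope.
Local Open Scope ring_scope.

(** The subspace is built together with an operator on L_1 with values in it.

    Let T be an operator from L_1 to X that is not completely continuous.  Weakly
    null sequences of L_1 are equi-integrable ([weakly_null_equi_continuous]), so
    T is already far from compact on bounded functions.  Consequently
    ([operator_large_on_small_functions]) there are a positive delta and, for any
    finite set of conditions of the form: theta f is nearly 0, a function f with
    |f| <= 1 and |T f| >= delta that satisfies them.  Functions f_0, f_1, ... are
    chosen in this way one after the other.  The conditions on f_n say that its
    products with the densities prod_(k < n) (1 +- f_k) have almost no integral,
    so that the next densities remain almost normalized, and that the images of
    these products under T are nearly annihilated by finitely many functionals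
    norming what has been built before.  The images under T of the densities form
    a bounded dyadic tree in X.  Such a tree defines an operator on L_1
    ([tree_operator]), which maps the n-th Rademacher function to T f_n, of norm
    at least delta.  As the Rademacher functions are weakly null, the space in
    which the tree lives fails the complete continuity property
    ([rademacher_not_CCP]).

    It remains to perturb the tree so that it lives in a space with a basis.  At
    step n, 2^n new vectors, nearly annihilated by functionals norming the
    previous span, have to be adjoined to a finite basic sequence.  This gives
    almost contractive projections on the previous spans, but only a finite
    dimensional decomposition, because the new vectors may be badly placed with
    respect to each other.  Here the copies of l_infty^n are used: one can be
    found in the kernel of any finite set of functionals ([linfty_in_kernel]).
    Each new vector is cut into many small slices, and the slices, taken in
    rounds, are corrected by vectors of such a copy that record the deviation of
    the partial sums from a steady growth.  The block so obtained has a basis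
    constant that depends on X only, and it spans vectors arbitrarily close to
    the new ones, since for these the growth is almost steady
    ([basic_block_extension]).  By Grunblum's criterion
    ([basic_sequence_schauder]) the resulting sequence is a basis of its closed
    span. *)

(** * Norming functionals *)

Section norming_functionals.
Context (R : realType) (V : normedModType R).
Implicit Types (x y v : V) (r c : R) (G : set (V * R)).

(** A partial functional is encoded by its graph.  Linearity and the bound by the
    norm make such a graph single valued, and both are inherited by unions of
    chains. *)
Let subgraph G := (forall a x y r s, G (x, r) -> G (y, s) ->
    G (a *: x + y, a * r + s)) /\ (forall x r, G (x, r) -> r <= `|x|).

(** One more dimension: the value at [v] may be any number between the supremum
    of the [r - |x - v|] and the infimum of the [|x + v| - r]. *)
Let extend_subgraph G v : subgraph G -> G (0, 0) ->
  exists c, subgraph [set z | exists x r a,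
    G (x, r) /\ z = (x + a *: v, r + a * c)].
Proof.
move=> [Glin Gle] G0.
pose lo := [set u | exists x r, G (x, r) /\ u = r - `|x - v|].
have lo_up x r : G (x, r) -> ubound lo (`|x + v| - r).
  move=> Gx _ [y [s [Gy ->]]]; have := Gle _ _ (Glin 1 _ _ _ _ Gx Gy).
  rewrite scale1r mul1r => le1.
  have : `|x + y| <= `|x + v| + `|y - v|.
    by rewrite (_ : x + y = (x + v) + (y - v)) ?ler_normD// addrACA subrr addr0.
  lra.
have lo_sup : has_sup lo.
  split; first by exists (0 - `|0 - v|), 0, 0.
  by exists (`|0 + v| - 0); exact: lo_up.
pose c := sup lo; exists c.
have cle x r : G (x, r) -> r + c <= `|x + v|.
  by move=> Gx; have := ge_sup lo_sup.1 (lo_up _ _ Gx); rewrite -/c; lra.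
have cge x r : G (x, r) -> r - c <= `|x - v|.
  move=> Gx; have : r - `|x - v| <= c by apply: ub_le_sup lo_sup.2 _ _; exists x, r.
  lra.
have Gscale a x r : G (x, r) -> G (a *: x, a * r).
  by move=> Gx; have := Glin a _ _ _ _ Gx G0; rewrite !addr0.
split=> [a x y r s [x1 [r1 [a1 [G1 [-> ->]]]]] [x2 [r2 [a2 [G2 [-> ->]]]]]|].
  exists (a *: x1 + x2), (a * r1 + r2), (a * a1 + a2); split; first exact: Glin.
  by congr (_, _); [rewrite scalerDr scalerDl scalerA addrACA|ring].
move=> _ _ [x [r [a [Gx [-> ->]]]]]; have [a0|a0|->] := ltgtP a 0; last first.
- by rewrite scale0r mul0r !addr0; exact: Gle.
- have := cle _ _ (Gscale a^-1 _ _ Gx).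
  rewrite -(ler_pM2l a0) mulrDr mulrA divff ?gt_eqF// mul1r => /le_trans; apply.
  rewrite -{1}(gtr0_norm a0) -normrZ scalerDr scalerA divff ?gt_eqF// scale1r.
  by [].
- have a0' : 0 < - a by rewrite oppr_gt0.
  have := cge _ _ (Gscale (- a)^-1 _ _ Gx).
  rewrite -(ler_pM2l a0') mulrBr mulrA divff ?gt_eqF// mul1r mulNr opprK.
  move=> /le_trans; apply.
  rewrite -{1}(gtr0_norm a0') -normrZ scalerBr scalerA divff ?gt_eqF// scale1r.
  by rewrite scaleNr opprK.
Qed.

(** A maximal graph containing the line through [(x0, |x0|)] is total, by the
    extension by one dimension. *)
Lemma Hahn_Banach_norming x0 : exists phi : {linear V -> R^o},
  (forall x, `|phi x| <= `|x|) /\ phi x0 = `|x0|.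
Proof.
pose line := [set z : V * R | exists a, z = (a *: x0, a * `|x0|)].
pose P G := subgraph G /\ line `<=` G.
have Pline : P line.
  split=> //; split=> [a _ _ _ _ [b [-> ->]] [c [-> ->]]|_ _ [a [-> ->]]].
    by exists (a * b + c); rewrite scalerDl scalerA mulrDl mulrA.
  by rewrite normrZ ler_wpM2r// ler_norm.
(* The empty graph is admitted because the union of the empty chain is empty. *)
have [G0 [[PG0|G0E] G0max]] : exists A, (P A \/ A = set0) /\
    forall B, A `<` B -> ~ (P B \/ B = set0).
  apply: (@Zorn_bigcup _ [set A | P A \/ A = set0]) => F FP Ftot /=.
  have [[A [FA PA]]|noP] := pselect (exists A, F A /\ P A); last first.
    right; apply/seteqP; split=> // z [A FA Az].
    by have [PA|A0] := FP _ FA; [case: noP; exists A|rewrite A0 in Az].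
  left; split; last by move=> z /(PA.2 z) Az; exists A.
  split=> [a x y r s [B FB Bx] [C FC Cy]|x r [B FB Bx]].
    have sub B' x' r' : F B' -> B' (x', r') -> P B'.
      by move=> FB' B'x; have [//|B0] := FP _ FB'; rewrite B0 in B'x.
    have [BC|CB] := Ftot _ _ FB FC.
    - by exists C => //; apply: (sub _ _ _ FC Cy).1.1 => //; exact: BC.
    - by exists B => //; apply: (sub _ _ _ FB Bx).1.1 => //; exact: CB.
  have [PB|B0] := FP _ FB; last by rewrite B0 in Bx.
  exact: PB.1.2 Bx.
- have [[Glin Gle] lineG] := PG0.
  have G00 : G0 (0, 0) by apply: lineG; exists 0; rewrite scale0r mul0r.
  have Gdom v : exists r, G0 (v, r).
    have [c cP] := extend_subgraph v PG0.1 G00.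
    apply: contrapT => nv; pose B := [set z | exists x r a,
      G0 (x, r) /\ z = (x + a *: v, r + a * c)].
    have GB : G0 `<=` B.
      by move=> [x r] Gx; exists x, r, 0; rewrite scale0r mul0r !addr0.
    apply: (G0max B); last by left; split => // z /lineG/GB.
    split=> // BG; apply: nv; exists (0 + 1 * c); apply: BG.
    by exists 0, 0, 1; rewrite scale1r !add0r.
  have Guniq x r s : G0 (x, r) -> G0 (x, s) -> r = s.
    have half r' s' : G0 (x, r') -> G0 (x, s') -> s' <= r'.
      move=> Gr Gs; have := Gle _ _ (Glin (-1) _ _ _ _ Gr Gs).
      by rewrite scaleN1r addNr normr0 mulN1r addrC subr_le0.
    by move=> Gr Gs; apply/eqP; rewrite eq_le !half.
  have [phi phiP] := choice Gdom.
  have lin_phi : linear (phi : V -> R^o).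
    move=> a x y; apply: (@Guniq (a *: x + y)) => //.
    by have := Glin a _ _ _ _ (phiP x) (phiP y).
  pose lphi := GRing.isLinear.Build _ _ _ _ (phi : V -> R^o) lin_phi.
  pose Phi : {linear V -> R^o} := HB.pack (phi : V -> R^o) lphi.
  have le_phi x : phi x <= `|x| by exact: Gle (phiP x).
  exists Phi; split=> [x|].
    rewrite ler_norml le_phi andbT lerNl -normrN.
    by have -> : - phi x = phi (- x) by rewrite -[LHS](linearN Phi).
  apply: (@Guniq x0); first exact: phiP.
  by apply: lineG; exists 1; rewrite scale1r mul1r.
- by case: (G0max line); [rewrite G0E; split => // /(_ (0, 0)) []; exists 0;
    rewrite scale0r mul0r|left].
Qed.

End norming_functionals.

(** * Finite norming families *)

Section finite_nets.
Context (R : realType).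

Lemma unit_interval_grid (n : nat) : (0 < n)%N ->
  exists (N : nat) (cell : R -> 'I_N) (val : 'I_N -> R),
    forall x, `|x| <= 1 -> `|x - val (cell x)| <= n%:R^-1.
Proof.
move=> n0; have n0R : 0 < n%:R :> R by rewrite ltr0n.
exists (2 * n).+1, (fun x => inord (Num.truncn ((x + 1) * n%:R))),
  (fun k => k%:R / n%:R - 1) => x; rewrite ler_norml => /andP[x1 x2].
set y := (x + 1) * n%:R.
have y0 : 0 <= y by apply: mulr_ge0; [lra|exact: ltW].
have /andP[ky yk] := truncn_itv y0.
have kn : (Num.truncn y < (2 * n).+1)%N.
  rewrite ltnS -(ler_nat R) (le_trans ky)// natrM /y ler_wpM2r//; lra.
rewrite inordK// (_ : x - _ = (y - (Num.truncn y)%:R) / n%:R).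
  rewrite normrM [X in _ * X]gtr0_norm ?invr_gt0// ger0_norm ?subr_ge0//.
  rewrite -[leRHS]mul1r ler_wpM2r ?invr_ge0 ?(ltW n0R)// lerBlDl.
  by rewrite -natr1 in yk; rewrite ltW.
by rewrite /y; field; rewrite gt_eqF.
Qed.

Variables (V : normedModType R).

(** The estimate is stated with an error proportional to the size of the
    coefficients, so that it needs no linear independence of the [v j]: the
    coefficients of norm at most 1 are approximated by a finite grid, and one
    functional is chosen for each grid point. *)
Lemma finite_norming_family (J : finType) (v : J -> V) (tau : R) : 0 < tau ->
  exists (I : finType) (phi : I -> {linear V -> R^o}),
    (forall i x, `|phi i x| <= `|x|) /\
    forall (a : J -> R) t, 0 <= t -> (forall j, `|a j| <= t) -> exists i,
      `|\sum_j a j *: v j| <= `|phi i (\sum_j a j *: v j)| + tau * t.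
Proof.
move=> tau0; pose S := \sum_j `|v j|.
have S0 : 0 <= S by apply: sumr_ge0.
pose n := (Num.truncn (2 * S / tau)).+1.
have n0 : 0 < n%:R :> R by rewrite ltr0n.
have Sn : S / n%:R <= tau / 2.
  have := truncnS_gt (2 * S / tau); rewrite -/n ltr_pdivrMr// => lt2S.
  rewrite ler_pdivrMr// mulrAC ler_pdivlMr// mulrC [tau * _]mulrC; exact: ltW.
have [N [cell [val gridP]]] := unit_interval_grid (ltn0Sn _ : (0 < n)%N).
pose pt (g : {ffun J -> 'I_N}) := \sum_j val (g j) *: v j.
have [phi phiP] := choice (fun g => Hahn_Banach_norming (pt g)).
exists {ffun J -> 'I_N}, phi; split=> [g x|a t t0 aP]; first exact: (phiP g).1.
have a0 j : t == 0 -> a j = 0.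
  by move=> /eqP t00; apply/eqP; rewrite -normr_le0 -t00.
pose b j := a j / t.
have aE j : a j = t * b j.
  rewrite /b mulrC; have [/a0 ->|tn0] := boolP (t == 0); first by rewrite !mul0r.
  by rewrite divfK.
have b1 j : `|b j| <= 1.
  rewrite /b; have [/a0 ->|tn0] := boolP (t == 0); first by rewrite mul0r normr0.
  by rewrite normrM normfV [X in _ / X]ger0_norm// ler_pdivrMr ?lt0r ?tn0// mul1r.
pose g := [ffun j => cell (b j)].
have -> : \sum_j a j *: v j = t *: \sum_j b j *: v j.
  by rewrite scaler_sumr; apply: eq_bigr => j _; rewrite aE scalerA.
set y := \sum_j _.
have yg : `|y - pt g| <= tau / 2.
  rewrite /y /pt -sumrB (le_trans _ Sn)// mulrC /S mulr_sumr.
  rewrite (le_trans (ler_norm_sum _ _ _))//; apply: ler_sum => j _.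
  by rewrite ffunE -scalerBl normrZ ler_wpM2r// gridP.
have [phi1 phig] := phiP g.
exists g; rewrite linearZ/= !normrZ (ger0_norm t0).
rewrite [tau * t]mulrC -mulrDr ler_wpM2l//.
have := phi1 (y - pt g); rewrite linearB/= phig => le1.
have := ler_normD (y - pt g) (pt g); rewrite subrK => le2.
have : `|pt g| <= `|phi g y| + `|phi g y - `|pt g| |.
  have := ler_normD (phi g y) (`|pt g| - phi g y).
  by rewrite subrKC normr_id (distrC _ (phi g y)).
lra.
Qed.

End finite_nets.

(** * Copies of l_infty in the kernel of finitely many functionals *)

Section linsub_values.
Context (R : realType) (V : normedModType R) (S : submodClosed V).

Lemma linsub_valZ a (x : linsub S) : val (a *: x) = a *: val x.
Proof. by rewrite linearZ. Qed.

Lemma linsub_valD (x y : linsub S) : val (x + y) = val x + val y.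
Proof. exact: raddfD. Qed.

Lemma linsub_val_sum I (r : seq I) (P : pred I) (F : I -> linsub S) :
  val (\sum_(i <- r | P i) F i) = \sum_(i <- r | P i) val (F i).
Proof. exact: raddf_sum. Qed.

End linsub_values.

Section linfty_in_kernels.
Context (R : realType).

Lemma kernel_row_unit_norm (s : nat) (A : 'M[R]_(s.+1, s)) :
  exists u : 'rV[R]_s.+1, [/\ u *m A = 0, forall j, `|u 0 j| <= 1
    & exists j, `|u 0 j| = 1].
Proof.
have : kermx A != 0.
  by rewrite kermx_eq0 -row_leq_rank -ltnNge ltnS rank_leq_col.
move=> /rowV0Pn[v /sub_kermxP vA v0].
have nv0 : `|v| != 0 by rewrite normr_eq0.
have [[i j] vj] := mx_norm_neq0 nv0; rewrite /= (ord1 i) in vj.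
exists (`|v|^-1 *: v); split; first by rewrite -scalemxAl vA scaler0.
- move=> k; rewrite mxE normrM normfV normr_id.
  rewrite -[leRHS](mulVf nv0) ler_wpM2l ?invr_ge0//.
  by rewrite [leRHS]/Num.norm /= mx_normrE; apply/bigmax_geP; right => /=; exists (0, k).
- by exists j; rewrite mxE normrM normfV normr_id -vj mulVf.
Qed.

Variables (V : normedModType R).

(** Copies of l_infty^n can be found inside the kernel of finitely many
    functionals: split the coordinates of a larger l_infty into groups with one
    more coordinate than there are functionals.  Each group carries a
    normalized vector on which all the functionals vanish, and disjointly
    supported normalized vectors of l_infty span again an l_infty. *)
Lemma linfty_in_kernel : fails_cotype V -> exists2 C : R, 0 < C &
  forall (Q I : finType) (phi : I -> {linear V -> R^o}), exists g : Q -> V,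
    [/\ forall i q, phi i (g q) = 0,
        forall (a : Q -> R) q, `|a q| <= `|\sum_q a q *: g q|
      & forall (a : Q -> R) (t : R), 0 <= t -> (forall q, `|a q| <= t) ->
          `|\sum_q a q *: g q| <= C * t].
Proof.
move=> [C0 VC]; exists (Num.max C0 1); first by rewrite lt_max ltr01 orbT.
move=> Q I phi; set C := Num.max C0 1.
have [E [J [K [a0 [b0 [JK _ Ja Kb ab]]]]]] := VC (#|Q| * #|I|.+1)%N.
pose e (q : Q) j : 'rV[R]_(#|Q| * #|I|.+1) := mxvec (delta_mx (enum_rank q) j).
pose A q : 'M[R]_(#|I|.+1, #|I|) :=
  \matrix_(j, i) (phi (enum_val i) (val (J (e q j))) : R).
have [u uP] := choice (fun q => kernel_row_unit_norm (A q)).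
pose w q := \sum_j u q 0 j *: e q j.
have wE (a : Q -> R) : \sum_q a q *: w q =
    mxvec (\matrix_(k, j) (a (enum_val k) * u (enum_val k) 0 j)).
  have -> : \sum_q a q *: w q =
      mxvec (\sum_q a q *: \sum_j u q 0 j *: delta_mx (enum_rank q) j).
    rewrite linear_sum; apply: eq_bigr => q _; rewrite linearZ; congr (_ *: _).
    by rewrite linear_sum; apply: eq_bigr => j _; rewrite linearZ.
  congr mxvec; apply/matrixP => k j; rewrite summxE mxE (bigD1 (enum_val k))//=.
  rewrite [X in _ + X]big1 ?addr0 => [|q qk]; last first.
    rewrite mxE summxE big1 ?mulr0// => l _; rewrite !mxE.
    by rewrite [k == _]eq_sym -(inj_eq enum_val_inj) enum_rankK (negbTE qk) mulr0.
  rewrite mxE summxE (bigD1 j)//= [X in _ + X]big1 ?addr0 => [|l lj]; last first.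
    by rewrite !mxE [j == _]eq_sym (negbTE lj) andbF mulr0.
  by rewrite !mxE enum_valK !eqxx mulr1.
pose g q : V := val (b0 *: J (w q)).
have gE (a : Q -> R) : \sum_q a q *: g q = val (b0 *: J (\sum_q a q *: w q)).
  rewrite linear_sum scaler_sumr linsub_val_sum; apply: eq_bigr => q _.
  by rewrite [J _]linearZ /g -linsub_valZ !scalerA mulrC.
(* Scaling by [b0] makes the embedding expansive. *)
exists g; split=> [i q|a q|a t t0 aP].
- rewrite /g.
  have -> : val (b0 *: J (w q)) = \sum_j (b0 * u q 0 j) *: val (J (e q j)).
    rewrite linear_sum scaler_sumr linsub_val_sum; apply: eq_bigr => j _.
    by rewrite [J _]linearZ scalerA linsub_valZ.
  rewrite linear_sum; have [/rowP/(_ (enum_rank i)) + _ _] := uP q.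
  rewrite !mxE => uA0; transitivity (b0 * 0); last by rewrite mulr0.
  rewrite -[X in _ = _ * X]uA0 mulr_sumr; apply: eq_bigr => j _.
  by rewrite linearZ/= mxE enum_rankK mulrA.
- rewrite gE -linsub_normE.
  have [_ _ [j uj]] := uP q.
  apply: (@le_trans _ _ `|\sum_q a q *: w q|).
    rewrite wE [leRHS]/Num.norm/= mx_normrE; apply/bigmax_geP; right => /=.
    exists (0, mxvec_index (enum_rank q) j) => //=.
    by rewrite mxvecE mxE enum_rankK normrM uj mulr1.
  rewrite -{1}[X in `|X|]JK (le_trans (Kb _))// normrZ ler_wpM2r//; exact: ler_norm.
- rewrite gE -linsub_normE normrZ.
  have wt : `|\sum_q a q *: w q| <= t.
    rewrite wE [leLHS]/Num.norm/= mx_normrE; apply/bigmax_leP; split => //=.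
    move=> [i k] _ /=; rewrite (ord1 i); case/mxvec_indexP: k => k j.
    rewrite mxvecE mxE normrM -[leRHS]mulr1 ler_pM//.
    by have [_ + _] := uP (enum_val k); apply.
  have C00 : 0 <= C by rewrite le_max ler01 orbT.
  apply: (@le_trans _ _ (C * `|\sum_q a q *: w q|)); last exact: ler_wpM2l.
  have [b00|b00] := leP 0 b0.
    rewrite ger0_norm// (le_trans (ler_wpM2l b00 (Ja _)))// mulrA ler_wpM2r//.
    by rewrite mulrC (le_trans ab)// le_max lexx.
  (* A negative bound on the norm of [K] forces the space to be null. *)
  have : 0 <= b0 * `|J (\sum_q a q *: w q)| by exact: le_trans (Kb _).
  rewrite nmulr_rge0// normr_le0 => /eqP ->.
  by rewrite normr0 mulr0 mulr_ge0.
Qed.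

End linfty_in_kernels.

(** * Extending a basic sequence by a block *)

(** Among the first p indices, k is met once in each of the p %/ M complete
    rounds, and once more if the current round has passed it. *)
Lemma count_residue_class (M k p : nat) : (k < M)%N ->
  (\sum_(i < p) (i %% M == k) = p %/ M + (k < p %% M))%N.
Proof.
move=> kM; have M0 : (0 < M)%N by exact: leq_ltn_trans kM.
elim: p => [|p IH]; first by rewrite big_ord0 div0n mod0n.
rewrite big_ord_recr/= IH {IH}.
have pE := divn_eq p M; have pM := ltn_pmod p M0.
set r := (p %% M)%N in pE pM *; set h := (p %/ M)%N in pE *.
have [rM|Mr] := ltnP r.+1 M.
  rewrite (_ : p.+1 = (h * M + r.+1)%N) ?divnMDl// ?modnMDl; last by lia.
  by rewrite divn_small// modn_small// addn0 -addnA; congr addn; lia.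
have {Mr pM}rM : r.+1 = M by lia.
rewrite (_ : p.+1 = h.+1 * M)%N ?mulnK// ?modnMl; last by rewrite pE; lia.
lia.
Qed.

Section block_extension.
Context (R : realType) (V : normedModType R).

Lemma functionalZ (f : {linear V -> R^o}) a x : f (a *: x) = a * f x.
Proof. by rewrite linearZ. Qed.

Definition combination (b : nat -> V) (a : nat -> R) n := \sum_(i < n) a i *: b i.

(** Quantitative linear independence of the first [n] vectors. *)
Definition coefficients_bounded (b : nat -> V) n := exists2 c : R, 0 < c &
  forall (a : nat -> R) i, (i < n)%N -> c * `|a i| <= `|combination b a n|.

(** The block consists of the vectors [w i + u i], where the corrections [u i] lie
    in a copy of l_infty spanned by [g].  The functionals [phi] norm the span of
    the old vectors and nearly vanish on the [w i]; the functionals [psi] norm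
    the span of the old vectors and of the [w i].  All of them vanish on [g]. *)
Section block_estimates.
Variables (d L : nat) (b w : nat -> V) (c tau e1 C : R).
Variables (I J : finType) (phi : I -> {linear V -> R^o}).
Variable psi : J -> {linear V -> R^o}.
Local Notation Q := ('I_L.+1 * J + 'I_L)%type.
Variables (lam : nat -> R) (g : Q -> V).

Hypotheses (c0 : 0 < c) (tau0 : 0 < tau) (e10 : 0 <= e1) (C0 : 0 < C).
Hypothesis e18 : e1 <= 1 / 8.
Hypothesis lam01 : forall p, 0 <= lam p <= 1.
Hypothesis phi1 : forall i x, `|phi i x| <= `|x|.
Hypothesis psi1 : forall j x, `|psi j x| <= `|x|.
Hypothesis b_lower : forall (a : nat -> R) i, (i < d)%N -> c * `|a i| <= `|combination b a d|.
Hypothesis phi_norming : forall a, exists i,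
  (1 - e1) * `|combination b a d| <= `|phi i (combination b a d)|.
Hypothesis phi_w : forall i (a : nat -> R) (t : R), 0 <= t ->
  (forall j, (j < L)%N -> `|a j| <= t) ->
  `|phi i (combination w a L)| <= e1 * (tau * t).
Hypothesis psi_norming : forall (a a' : nat -> R) (t : R), 0 <= t ->
  (forall i, (i < d)%N -> `|a i| <= t) -> (forall i, (i < L)%N -> `|a' i| <= t) ->
  exists j, let y := combination b a d + combination w a' L in
    `|y| <= `|psi j y| + Num.min c tau / 8 * t.
Hypothesis phi_g : forall i q, phi i (g q) = 0.
Hypothesis psi_g : forall j q, psi j (g q) = 0.
Hypothesis g_lower : forall (a : Q -> R) q, `|a q| <= `|\sum_q a q *: g q|.
Hypothesis g_upper : forall (a : Q -> R) (t : R), 0 <= t -> (forall q, `|a q| <= t) ->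
  `|\sum_q a q *: g q| <= C * t.

(** The coordinates of the corrections in l_infty.  For a combination with
    coefficients [a], of partial sums S_p and total S in the [w i], the
    coordinate [inl (p, j)] is [psi j (S_p - lam p S)] and the coordinate [inr j]
    is [tau * a j].  Subtracting the proportion [lam p] of the total is what
    makes the corrections small on the combinations that matter, while S_p can
    still be recovered from S and from the correction. *)
Definition block_coord (q : Q) (i : nat) : R :=
  match q with
  | inl (p, j) => psi j (((i < p)%:R - lam p) *: w i)
  | inr j => tau * (j == i :> nat)%:R
  end.

Definition block_correction i : V := \sum_q block_coord q i *: g q.

Local Notation u := block_correction.
Local Notation cut a p := (fun i : nat => (i < p)%:R * a i : R).

Let correctionE (a : nat -> R) : combination u a L =
  \sum_q (\sum_(i < L) a i * block_coord q i) *: g q.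
Proof.
rewrite /combination /u; under eq_bigr do rewrite scaler_sumr.
rewrite exchange_big; apply: eq_bigr => q _; rewrite scaler_suml.
by apply: eq_bigr => i _; rewrite scalerA.
Qed.

Let coord_inl (a : nat -> R) p j : \sum_(i < L) a i * block_coord (inl (p, j)) i =
  psi j (combination w (cut a p) L - lam p *: combination w a L).
Proof.
rewrite /combination scaler_sumr -sumrB linear_sum; apply: eq_bigr => i _ /=.
by rewrite scalerA -scalerBl !functionalZ; ring.
Qed.

Let coord_inr (a : nat -> R) (j : 'I_L) :
  \sum_(i < L) a i * block_coord (inr j) i = tau * a j.
Proof.
rewrite (bigD1 j)//= eqxx big1 ?addr0 => [|i ij]; first by rewrite mulr1 mulrC.
by rewrite [_ == _]eq_sym (inj_eq val_inj) (negbTE ij) !mulr0.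
Qed.

Let combination_cut (v : nat -> V) a p q :
  combination v (cut (cut a q) p) L = combination v (cut a (minn p q)) L.
Proof.
apply: eq_bigr => i _; congr (_ *: _); rewrite mulrA -natrM mulnb.
by rewrite -leq_min.
Qed.

Let le_u a i : (i < L)%N -> tau * `|a i| <= `|combination u a L|.
Proof.
move=> iL; rewrite correctionE.
have := g_lower (fun q => \sum_(i < L) a i * block_coord q i) (inr (Ordinal iL)).
by rewrite coord_inr normrM gtr0_norm.
Qed.

Let phi_u i a : phi i (combination u a L) = 0.
Proof.
rewrite correctionE linear_sum big1// => q _.
by rewrite linearZ/= phi_g scaler0.
Qed.

Let psi_u i a : psi i (combination u a L) = 0.
Proof.
rewrite correctionE linear_sum big1// => q _.
by rewrite linearZ/= psi_g scaler0.
Qed.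

Let le_u_tau a i : (i < L)%N -> `|a i| <= `|combination u a L| / tau.
Proof. by move=> iL; rewrite ler_pdivlMr// mulrC le_u. Qed.

Let c_min : Num.min c tau <= c. Proof. by rewrite ge_min lexx. Qed.
Let tau_min : Num.min c tau <= tau. Proof. by rewrite ge_min lexx orbT. Qed.

Let min_le s x : Num.min c tau <= s -> 0 < s -> 0 <= x ->
  Num.min c tau / 8 * (x / s) <= x / 8.
Proof.
move=> ms s0 x0; have xs0 : 0 <= x / s by rewrite divr_ge0// ltW.
have -> : x / 8 = s / 8 * (x / s) by field; rewrite gt_eqF.
by rewrite ler_wpM2r// ler_wpM2r.
Qed.

(** The partial sums of the [w i] are controlled by their total and by the
    correction, through the coordinates [inl (p, j)]. *)
Let cut_le (a : nat -> R) p : `|combination w (cut a p) L| <=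
  `|combination w a L| + 2 * `|combination u a L|.
Proof.
wlog pL : p / (p <= L)%N.
  move=> H; rewrite (_ : combination _ _ _ = combination w (cut a (minn p L)) L).
    by apply: H; rewrite geq_minr.
  by apply: eq_bigr => i _; rewrite /= leq_min ltn_ord andbT.
set U := `|combination u a L|.
pose a' i := ((i < p)%:R - lam p) * a i.
have U0 : 0 <= U by exact: normr_ge0.
have /andP[l0 l1] := lam01 p.
have a't i : (i < L)%N -> `|a' i| <= U / tau.
  move=> iL; rewrite /a' normrM (le_trans _ (le_u_tau a iL))// ler_piMl//.
  by rewrite ler_norml; case: (i < p)%N => /=; apply/andP; split; lra.
have Ut0 : 0 <= U / tau by rewrite divr_ge0// ltW.
have [||j] := @psi_norming (fun=> 0) a' _ Ut0.
- by move=> i _; rewrite normr0.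
- exact: a't.
rewrite /= (_ : combination b _ _ = 0) ?add0r; last first.
  by rewrite /combination big1// => i _; rewrite scale0r.
have -> : combination w a' L = combination w (cut a p) L - lam p *: combination w a L.
  rewrite /combination scaler_sumr -sumrB; apply: eq_bigr => i _ /=.
  by rewrite scalerA -scalerBl /a' mulrBl.
set y := _ - _ => le1.
have le2 : `|psi j y| <= U.
  have := g_lower (fun q => \sum_(i < L) a i * block_coord q i)
    (inl (inord p, j)).
  by rewrite -correctionE coord_inl inordK.
have le3 := min_le tau_min tau0 U0.
have -> : combination w (cut a p) L = y + lam p *: combination w a L.
  by rewrite subrK.
have : `|lam p *: combination w a L| <= `|combination w a L|.
  by rewrite normrZ ger0_norm// ler_piMl.
by have := ler_normD y (lam p *: combination w a L); lra.
Qed.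

(** The three parts of a combination are controlled by the whole: [psi] bounds the
    first two together because it does not see the corrections, and [phi] bounds
    the first one because it hardly sees the other two, whose coefficients are
    bounded by the correction. *)
Lemma block_norms a a' (X := `|combination b a d + combination w a' L +
    combination u a' L|) :
  [/\ `|combination b a d| <= (1 + 8 * e1) * X,
      `|combination w a' L| <= 5 * X & `|combination u a' L| <= 4 * X].
Proof.
have := e18; have := e10 => e10' e18'.
set Z := combination b a d; set E := combination w a' L.
set U := combination u a' L; rewrite -/Z -/E -/U in X *.
have U0 : 0 <= `|U| by exact: normr_ge0. have Z0 : 0 <= `|Z| by exact: normr_ge0.
have le1 : `|U| <= X + `|Z + E|.
  by have := ler_normB (Z + E + U) (Z + E); rewrite (addrC _ U) addrK addrC.
have le2 : `|Z + E| <= X + (`|Z| + `|U|) / 8.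
  have t0 : 0 <= `|Z| / c + `|U| / tau by rewrite addr_ge0// divr_ge0// ltW.
  have [||j] := @psi_norming a a' _ t0.
  - move=> i id; rewrite (@le_trans _ _ (`|Z| / c))//.
      by rewrite ler_pdivlMr// mulrC b_lower.
    by rewrite lerDl divr_ge0// ltW.
  - move=> i iL; rewrite (le_trans (le_u_tau _ iL))// lerDr divr_ge0// ltW//.
  rewrite -/Z -/E /= mulrDr.
  have := min_le c_min c0 Z0; have := min_le tau_min tau0 U0.
  have := psi1 j (Z + E + U); rewrite linearD /= psi_u addr0 -/X; lra.
have [i le3] := phi_norming a; rewrite -/Z in le3.
have le4 : `|phi i E| <= e1 * `|U|.
  have -> : e1 * `|U| = e1 * (tau * (`|U| / tau)).
    by rewrite (mulrC tau) divfK ?gt_eqF.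
  by apply: phi_w => [|j]; [rewrite divr_ge0// ltW|exact: le_u_tau].
have le5 : `|phi i Z| <= X + e1 * `|U|.
  have := phi1 i (Z + E + U); rewrite !linearD/= phi_u addr0 -/X.
  by have := ler_normB (phi i Z + phi i E) (phi i E); rewrite addrK; lra.
have X0 : 0 <= X by exact: normr_ge0.
have le6 : `|U| <= (16 * X + `|Z|) / 7 by lra.
have le7 : `|Z| <= (1 + 8 * e1) * X.
  have h1 : (1 - e1) * `|Z| <= X + e1 * ((16 * X + `|Z|) / 7).
    by rewrite (le_trans le3)// (le_trans le5)// lerD2l ler_wpM2l.
  have h2 : 0 <= X * e1 * (1 - 2 * e1) by apply: mulr_ge0; [exact: mulr_ge0|lra].
  have e1' : 0 < 1 - 8 / 7 * e1 by lra.
  by rewrite -(ler_pM2l e1'); lra.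
have e2 : 1 + 8 * e1 <= 2 by lra.
have le8 : `|Z| <= 2 * X by rewrite (le_trans le7)// ler_wpM2r.
split; [exact: le7| |lra].
by have := ler_normB (Z + E) Z; rewrite [Z + E - Z]addrAC subrr add0r; lra.
Qed.

Lemma block_cut_norms a a' p (X := `|combination b a d + combination w a' L +
    combination u a' L|) :
  `|combination b a d + combination w (cut a' p) L + combination u (cut a' p) L|
    <= (15 + 26 * C) * X.
Proof.
have := e18; have := e10 => e10' e18'.
have [le1 le2 le3] := block_norms a a'; rewrite -/X in le1 le2 le3.
have X0 : 0 <= X by exact: normr_ge0.
have le4 q : `|combination w (cut a' q) L| <= 13 * X.
  by rewrite (le_trans (cut_le _ _))//; lra.
have le5 : `|combination u (cut a' p) L| <= C * (26 * X).
  rewrite correctionE; apply: g_upper => [|[[q j]|j]]; first exact: mulr_ge0.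
    rewrite (coord_inl (cut a' p)) (le_trans (psi1 _ _))// combination_cut.
    have /andP[l0 l1] := lam01 q.
    rewrite (le_trans (ler_normB _ _))// normrZ ger0_norm//.
    have := le4 (minn q p); have := le4 p.
    have : lam q * `|combination w (cut a' p) L| <= `|combination w (cut a' p) L|.
      by rewrite ler_piMl.
    lra.
  rewrite (coord_inr (cut a' p)) normrM gtr0_norm// normrM.
  rewrite (@le_trans _ _ (tau * `|a' j|))//.
    by rewrite ler_wpM2l ?(ltW tau0)// ler_piMl//; case: (j < p)%N; rewrite ?normr1 ?normr0.
  by rewrite (le_trans (le_u _ (ltn_ord j)))//; lra.
rewrite (le_trans (ler_normD _ _))// mulrDl -[26 * C]mulrC -mulrA lerD//.
rewrite (le_trans (ler_normD _ _))// (_ : 15 * X = 2 * X + 13 * X) ?lerD//; last by ring.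
by rewrite (le_trans le1)// ler_wpM2r//; lra.
Qed.

Lemma block_lower a a' i (X := `|combination b a d + combination w a' L +
    combination u a' L|) :
  ((i < d)%N -> c / 4 * `|a i| <= X) /\ ((i < L)%N -> tau / 4 * `|a' i| <= X).
Proof.
have := e18; have := e10 => e10' e18'.
have [le1 _ le3] := block_norms a a'; rewrite -/X in le1 le3.
have X0 : 0 <= X by exact: normr_ge0.
split=> [id|iL]; last by have := le_u a' iL; lra.
have := b_lower a id; have : (1 + 8 * e1) * X <= 4 * X by rewrite ler_wpM2r//; lra.
lra.
Qed.

Lemma block_correction_small a t : 0 <= t ->
  (forall i, (i < L)%N -> tau * `|a i| <= t) ->
  (forall p, (p <= L)%N ->
    `|combination w (cut a p) L - lam p *: combination w a L| <= t) ->
  `|combination u a L| <= C * t.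
Proof.
move=> t0 at0 wt; rewrite correctionE; apply: g_upper => [//|[[p j]|j]].
  by rewrite coord_inl (le_trans (psi1 _ _))// wt// -ltnS.
by rewrite coord_inr normrM gtr0_norm// at0.
Qed.

End block_estimates.

Lemma combination_extension (b w : nat -> V) (a : nat -> R) d L q
    (b' := fun i => if (i < d)%N then b i else w (i - d)%N) : (q <= L)%N ->
  combination b' a (d + q) =
  combination b a d + combination w (fun i => (i < q)%:R * a (d + i)%N) L.
Proof.
move=> qL; rewrite /combination big_split_ord/=; congr (_ + _).
  by apply: eq_bigr => i _; rewrite /b' /= ltn_ord.
rewrite (big_ord_widen L (fun i => a (d + i)%N *: b' (d + i)%N))// big_mkcond.
apply: eq_bigr => i _; rewrite /b' [(d + i < d)%N]ltnNge leq_addr/= addKn.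
by case: ifP => _; rewrite ?mul1r// mul0r scale0r.
Qed.

Lemma combinationD (b w : nat -> V) (a : nat -> R) n :
  combination (fun i => b i + w i) a n = combination b a n + combination w a n.
Proof. by rewrite /combination -big_split; apply: eq_bigr => i _; rewrite scalerDr. Qed.

Lemma combination_norming d (b : nat -> V) (tau : R) : 0 < tau ->
  exists (I : finType) (phi : I -> {linear V -> R^o}),
    (forall i x, `|phi i x| <= `|x|) /\
    forall (a : nat -> R) t, 0 <= t -> (forall j, (j < d)%N -> `|a j| <= t) ->
    exists i, `|combination b a d| <= `|phi i (combination b a d)| + tau * t.
Proof.
move=> tau0; have [I [phi [phi1 phiP]]] :=
  finite_norming_family (fun i : 'I_d => b i) tau0.
exists I, phi; split=> // a t t0 at0.
by apply: (phiP (fun i : 'I_d => a i)) => // j; exact: at0.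
Qed.

(** Finitely many given vectors can be adjoined approximately to a basic sequence,
    at the price of a block of bounded basis constant, provided that they are
    nearly annihilated by functionals norming the old span.  The [v k] themselves
    may form a very bad basis.  They are cut into m equal slices, and the block
    runs m times through [v 0 / m, ..., v (M - 1) / m], each slice being corrected
    in a copy of l_infty.  With [lam p] the proportion of the rounds completed
    before p, the partial sums of the slices of a single [v k] stay within
    [v k / m] of [lam p * v k].  Hence the corrections of these slices add up to
    a vector of norm of order 1 / m, although they control all the partial sums
    of the block. *)
Lemma basic_block_extension : fails_cotype V -> exists2 K : R, 0 < K &
  forall b d M (B e : R), coefficients_bounded b d ->
  (0 < M)%N -> 0 <= B -> 0 < e <= 1 ->
  exists (I : finType) (phi : I -> {linear V -> R^o}) (eta : R),
  [/\ 0 < eta, forall i x, `|phi i x| <= `|x| &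
  forall v : nat -> V, (forall k, (k < M)%N -> `|v k| <= B) ->
  (forall i k, (k < M)%N -> `|phi i (v k)| <= eta) ->
  exists b' d', [/\ (d < d')%N /\ (forall i, (i < d)%N -> b' i = b i),
    coefficients_bounded b' d',
    forall a, `|combination b' a d| <= (1 + e) * `|combination b' a d'|,
    forall a q, (d <= q <= d')%N ->
      `|combination b' a q| <= K * `|combination b' a d'|
  & forall k, (k < M)%N -> exists a, `|combination b' a d' - v k| <= e]].
Proof.
move=> /linfty_in_kernel[C C0 linf]; exists (15 + 26 * C); first by lra.
move=> b d M B e [c c0 cb] M0 B0 /andP[e0 e1le].
have M0R : 0 < M%:R :> R by rewrite ltr0n.
pose e1 := e / 8; have e10 : 0 < e1 by rewrite /e1; lra.
have e18 : e1 <= 1 / 8 by rewrite /e1; lra.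
pose tau := e / C; have tau0 : 0 < tau by rewrite divr_gt0.
pose m := (Num.truncn (B / tau)).+1.
have m0 : 0 < m%:R :> R by rewrite ltr0n.
have Bm : B / m%:R <= tau.
  by rewrite ler_pdivrMr// mulrC -ler_pdivrMr// ltW// truncnS_gt.
pose L := (m * M)%N.
have [I [phi [phi1 phiP]]] := combination_norming d b (mulr_gt0 c0 e10).
pose eta := e1 * tau / M%:R.
exists I, phi, eta; split; [by rewrite divr_gt0// mulr_gt0|exact: phi1|].
move=> v vB phiv; pose w i := m%:R^-1 *: v (i %% M)%N.
pose bw i := if (i < d)%N then b i else w (i - d)%N.
have ctau0 : 0 < Num.min c tau / 8 by rewrite divr_gt0// lt_min c0.
have [J [psi [psi1 psiP]]] := combination_norming (d + L) bw ctau0.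
pose Q := ('I_L.+1 * J + 'I_L)%type.
pose chi (s : I + J) := match s with inl i => phi i | inr j => psi j end.
have [g [chi_g g_lower g_upper]] := linf Q _ chi.
pose lam p : R := (minn (p %/ M) m)%:R / m%:R.
have lam01 p : 0 <= lam p <= 1.
  by rewrite divr_ge0//= ler_pdivrMr// mul1r ler_nat geq_minr.
have phi_norming a : exists i,
    (1 - e1) * `|combination b a d| <= `|phi i (combination b a d)|.
  have Zc0 : 0 <= `|combination b a d| / c by rewrite divr_ge0// ltW.
  have [j jd|i] := phiP a _ Zc0.
    by rewrite ler_pdivlMr// mulrC cb.
  have -> : c * e1 * (`|combination b a d| / c) = e1 * `|combination b a d|.
    by field; rewrite gt_eqF.
  by exists i; lra.
have phi_w i (a : nat -> R) t : 0 <= t -> (forall j, (j < L)%N -> `|a j| <= t) ->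
    `|phi i (combination w a L)| <= e1 * (tau * t).
  move=> t0 at0; rewrite linear_sum (le_trans (ler_norm_sum _ _ _))//.
  have -> : e1 * (tau * t) = \sum_(j < L) t * (eta / m%:R).
    rewrite sumr_const card_ord -[RHS]mulr_natl /L natrM /eta.
    by field; rewrite !gt_eqF.
  apply: ler_sum => j _; rewrite functionalZ normrM ler_pM ?at0//.
  rewrite /w functionalZ normrM normfV (gtr0_norm m0) [leRHS]mulrC.
  by rewrite ler_wpM2l ?invr_ge0 ?(ltW m0)// phiv// ltn_mod.
have psi_norming (a a' : nat -> R) (t : R) : 0 <= t ->
    (forall i, (i < d)%N -> `|a i| <= t) -> (forall i, (i < L)%N -> `|a' i| <= t) ->
    exists j, let y := combination b a d + combination w a' L in
      `|y| <= `|psi j y| + Num.min c tau / 8 * t.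
  move=> t0 at0 a't0.
  pose aa i := if (i < d)%N then a i else a' (i - d)%N.
  have [j jdL|j] := psiP aa t t0.
    rewrite /aa; case: ifPn => [|jd]; first exact: at0.
    by apply: a't0; rewrite ltn_subLR// leqNgt.
  exists j; move: p; rewrite (combination_extension _ _ _ _ (leqnn L)).
  have -> : combination b aa d = combination b a d.
    by apply: eq_bigr => i _; rewrite /aa ltn_ord.
  have -> // : combination w (fun i => (i < L)%:R * aa (d + i)%N) L = combination w a' L.
  apply: eq_bigr => i _; rewrite /aa ltn_ord mul1r.
  by rewrite [(d + i < d)%N]ltnNge leq_addr/= addKn.
have phi_g i q : phi i (g q) = 0 by exact: (chi_g (inl i)).
have psi_g j q : psi j (g q) = 0 by exact: (chi_g (inr j)).
pose u := block_correction w tau psi lam g.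
pose b' i := if (i < d)%N then b i else w (i - d)%N + u (i - d)%N.
have b'E a q : (q <= L)%N -> combination b' a (d + q) = combination b a d +
    combination w (fun i => (i < q)%:R * a (d + i)%N) L +
    combination u (fun i => (i < q)%:R * a (d + i)%N) L.
  by move=> qL; rewrite -addrA -combinationD; exact: combination_extension.
have b'EL a : combination b' a (d + L) = combination b a d +
    combination w (fun i => a (d + i)%N) L + combination u (fun i => a (d + i)%N) L.
  by rewrite b'E//; congr (_ + _ + _); apply: eq_bigr => i _; rewrite ltn_ord mul1r.
have b'd a : combination b' a d = combination b a d.
  by apply: eq_bigr => i _; rewrite /b' ltn_ord.
have norms := block_norms lam c0 tau0 (ltW e10) e18 phi1 psi1 cb
  phi_norming phi_w psi_norming phi_g psi_g g_lower.
have lower a a' i := block_lower lam c0 tau0 (ltW e10) e18 phi1 psi1 cb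
  phi_norming phi_w psi_norming phi_g psi_g g_lower a a' i.
exists b', (d + L)%N; split.
- split; first by rewrite -[ltnLHS]addn0 ltn_add2l muln_gt0 M0.
  by move=> i id; rewrite /b' id.
- exists (Num.min (c / 4) (tau / 4)) => [|a i idL].
    by rewrite lt_min !divr_gt0.
  rewrite b'EL.
  have [low1 low2] := lower a (fun i => a (d + i)%N) i.
  have [id|di] := ltnP i d.
    by rewrite (le_trans _ (low1 id))// ler_wpM2r// ge_min lexx.
  have [_ low3] := lower a (fun i => a (d + i)%N) (i - d)%N.
  rewrite subnKC// in low3.
  rewrite (le_trans _ (low3 _)) ?ler_wpM2r ?ge_min ?lexx ?orbT//.
  by rewrite ltn_subLR.
- move=> a; rewrite b'd b'EL.
  have [+ _ _] := norms a (fun i => a (d + i)%N).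
  by rewrite (_ : 1 + 8 * e1 = 1 + e)// /e1; field.
- move=> a q /andP[dq qL]; have qdL : (q - d <= L)%N by rewrite leq_subLR.
  rewrite -(subnKC dq) b'E// b'EL.
  exact: (block_cut_norms c0 tau0 (ltW e10) e18 lam01 phi1 psi1 cb
    phi_norming phi_w psi_norming phi_g psi_g g_lower g_upper).
- move=> k kM; exists (fun i => (d <= i)%N%:R * ((i - d)%N %% M == k)%N%:R).
  rewrite b'EL.
  set a := fun i : nat => _.
  pose ak (i : nat) : R := (i %% M == k)%N%:R.
  have -> : combination b a d = 0.
    by rewrite /combination big1// => i _; rewrite /a leqNgt ltn_ord mul0r scale0r.
  have aE : (fun i => a (d + i)%N) = ak.
    by apply/funext => i; rewrite /a leq_addr addKn mul1r.
  rewrite aE add0r.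
  have wcut p : (p <= L)%N -> combination w (fun i => (i < p)%:R * ak i) L =
      ((p %/ M)%:R / m%:R + (k < p %% M)%:R / m%:R) *: v k.
    move=> pL; rewrite -mulrDl -natrD -count_residue_class//.
    rewrite natr_sum mulr_suml scaler_suml.
    rewrite (big_ord_widen L (fun i => ((i %% M == k)%N%:R / m%:R) *: v k))// big_mkcond.
    apply: eq_bigr => i _; case: ifP => _; last by rewrite mul0r scale0r.
    rewrite mul1r /ak /w; case: eqP => [->|_]; last by rewrite mul0r !scale0r.
    by rewrite scalerA.
  have wk : combination w ak L = v k.
    transitivity (combination w (fun i => (i < L)%:R * ak i) L).
      by apply: eq_bigr => i _; rewrite ltn_ord mul1r.
    rewrite wcut// /L mulnK// modnMl ltn0 mul0r addr0 divff ?gt_eqF// scale1r.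
    by [].
  rewrite wk [v k + _]addrC addrK.
  have -> : e = C * tau by rewrite mulrC divfK// gt_eqF.
  apply: block_correction_small => //; first exact: ltW.
    move=> i _; apply: ler_piMr; first exact: ltW.
    by rewrite /ak; case: eqP; rewrite ?normr1 ?normr0.
  move=> p pL; rewrite wcut// wk -scalerBl normrZ.
  have pm : (p %/ M <= m)%N by rewrite -(mulnK m M0) leq_div2r.
  rewrite /lam (minn_idPl pm) addrAC subrr add0r.
  rewrite (le_trans _ Bm)// mulrC normrM (gtr0_norm (_ : 0 < m%:R^-1)) ?invr_gt0//.
  rewrite mulrA ler_wpM2r ?invr_ge0 ?(ltW m0)//.
  by rewrite (le_trans _ (vB k kM))// ler_piMr//; case: (k < _)%N; rewrite ?normr1 ?normr0.
Qed.

End block_extension.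

(** * Basic sequences and their closed spans *)

Section basic_sequences.
Context (R : realType) (X : completeNormedModType R).

Definition basic_sequence (K : R) (b : nat -> X) :=
  (forall i, b i != 0) /\ forall a p q, (p <= q)%N ->
    `|combination b a p| <= K * `|combination b a q|.

Variables (b : nat -> X).

Definition span_closure : set X := closure [set x | exists a n, x = combination b a n].

Lemma combination_cut (a : nat -> R) n p : (n <= p)%N ->
  combination b (fun i => (i < n)%:R * a i) p = combination b a n.
Proof.
move=> np; rewrite /combination (big_ord_widen p (fun i => a i *: b i))// [RHS]big_mkcond.
by apply: eq_bigr => i _; case: ifP => _; rewrite ?mul1r// mul0r scale0r.
Qed.

Lemma span_closureP x : span_closure x <->
  forall e, 0 < e -> exists a n, `|x - combination b a n| < e.
Proof.
split=> [Sx e e0|H].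
  have [_ [[a [n ->]]]] := Sx _ (nbhsx_ballx x e e0).
  by rewrite -ball_normE /= => le; exists a, n.
move=> B /nbhs_ballP[e /= e0 xB]; have [a [n le]] := H e e0.
by exists (combination b a n); split; [exists a, n|apply: xB; rewrite -ball_normE].
Qed.

Lemma combination_span_closure a n : span_closure (combination b a n).
Proof. by apply: subset_closure; exists a, n. Qed.

Definition span_closure_pred : {pred X} := fun x => `[< span_closure x >].

Let span_closure_submod : submod_closed span_closure_pred.
Proof.
split=> [|c x y].
  rewrite unfold_in; apply/asboolP; apply: subset_closure; exists (fun=> 0), 0%N.
  by rewrite /combination big_ord0.
rewrite !unfold_in => /asboolP/span_closureP Sx /asboolP/span_closureP Sy.
apply/asboolP/span_closureP => e e0.
have c0 : 0 < `|c| + 1 by rewrite ltr_wpDl.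
have [a [n lex]] := Sx (e / 2 / (`|c| + 1)) ltac:(by rewrite !divr_gt0).
have [a' [n' ley]] := Sy (e / 2) ltac:(by rewrite divr_gt0).
exists (fun i => c * ((i < n)%:R * a i) + (i < n')%:R * a' i), (maxn n n').
have -> : combination b (fun i => c * ((i < n)%:R * a i) + (i < n')%:R * a' i)
    (maxn n n') = c *: combination b a n + combination b a' n'.
  rewrite -(combination_cut a (leq_maxl n n')) -(combination_cut a' (leq_maxr n n')).
  rewrite /combination scaler_sumr -big_split; apply: eq_bigr => i _.
  by rewrite scalerDl scalerA.
rewrite opprD addrACA -scalerBr (le_lt_trans (ler_normD _ _))// normrZ.
rewrite [ltRHS]splitr; apply: ler_ltD => //.
rewrite (@le_trans _ _ ((`|c| + 1) * (e / 2 / (`|c| + 1))))//.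
  by rewrite ler_pM// ?lerDl// ltW.
by rewrite mulrC divfK// gt_eqF.
Qed.

HB.instance Definition _ :=
  GRing.isSubmodClosed.Build R X span_closure_pred span_closure_submod.

Definition closed_span : submodClosed X := span_closure_pred.

Lemma closed_spanE : [set` closed_span] = span_closure.
Proof.
by apply/funext => x; apply/propext; rewrite /= unfold_in; split => /asboolP.
Qed.

Lemma closed_closed_span : closed [set` closed_span].
Proof. by rewrite closed_spanE; exact: closed_closure. Qed.

Lemma mem_closed_span a n : combination b a n \in closed_span.
Proof. by rewrite unfold_in; apply/asboolP/combination_span_closure. Qed.

Lemma combinationB (a a' : nat -> R) n :
  combination b (fun i => a i - a' i) n = combination b a n - combination b a' n.
Proof. by rewrite /combination -sumrB; apply: eq_bigr => i _; rewrite scalerBl. Qed.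

Lemma combinationS a n : combination b a n.+1 = combination b a n + a n *: b n.
Proof. by rewrite /combination big_ord_recr. Qed.

Lemma combination_cvg (a : nat -> nat -> R) (l : nat -> R) n :
  (forall i, a ^~ i @ \oo --> l i) ->
  combination b (a m) n @[m --> \oo] --> combination b l n.
Proof.
move=> al; elim: n => [|n IH].
  rewrite (_ : (fun m => _) = cst 0) ?[combination _ _ 0]big_ord0; first exact: cvg_cst.
  by apply/funext => m; rewrite /combination big_ord0.
under eq_fun do rewrite combinationS.
rewrite combinationS; apply: cvgD => //; exact: cvgZr_tmp.
Qed.

Variable (K : R).
Hypothesis bK : basic_sequence K b.

Lemma basic_coefficient_bound a i n : (i < n)%N ->
  `|a i| * `|b i| <= 2 * K * `|combination b a n|.
Proof.
move=> ltin; rewrite -normrZ.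
have -> : a i *: b i = combination b a i.+1 - combination b a i.
  by rewrite combinationS addrC addKr.
rewrite (le_trans (ler_normB _ _))// -mulrA mulr_natl mulr2n.
by apply: lerD; apply: bK.2 => //; exact: ltnW.
Qed.

Let K0 : 0 <= K.
Proof.
have := bK.2 (fun=> 1) _ _ (leqnn 1).
rewrite combinationS [combination _ _ 0]big_ord0 add0r scale1r.
by rewrite -{1}[X in X <= _]mul1r ler_pM2r ?normr_gt0 ?bK.1// => /(le_trans ler01).
Qed.

(** Approximate [y] by finite combinations.  The coefficients of these form Cauchy
    sequences, and since the partial sums are uniformly bounded operators, the
    limit coefficients expand [y]. *)
Lemma basic_expansion y : span_closure y ->
  exists a : nat -> R, combination b a n @[n --> \oo] --> y.
Proof.
move=> /span_closureP Sy.
have harm0 n : 0 < n.+1%:R^-1 :> R by [].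
have [a0 a0P] := choice (fun n => Sy _ (harm0 n)).
have [N NP] := choice a0P.
pose a n i := (i < N n)%:R * a0 n i.
have yx n p : (N n <= p)%N -> `|y - combination b (a n) p| < n.+1%:R^-1.
  by move=> Np; rewrite combination_cut.
have a_cauchy n m p :
    `|combination b (a n) p - combination b (a m) p| <= K * (n.+1%:R^-1 + m.+1%:R^-1).
  set q := maxn p (maxn (N n) (N m)).
  have pq : (p <= q)%N by rewrite leq_maxl.
  rewrite -combinationB (le_trans (bK.2 _ _ _ pq))// ler_wpM2l// combinationB.
  have := yx n q; have := yx m q.
  rewrite !leq_max !leqnn !orbT => /(_ isT) lem /(_ isT) len.
  rewrite -[X in X - _](subrK y) -addrA (le_trans (ler_normD _ _))// distrC.
  by rewrite lerD// ltW.
have harm_small e : 0 < e -> exists n0, forall n, (n0 <= n)%N -> n.+1%:R^-1 < e :> R.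
  move=> e0; exists (Num.truncn e^-1) => n n0n.
  rewrite invf_plt ?posrE// (lt_le_trans (truncnS_gt _))//.
  by rewrite ler_nat ltnS.
have acvg i : exists l : R, a ^~ i @ \oo --> l.
  suff /cvg_ex[l al] : cvgn (a ^~ i) by exists l.
  apply: cauchy_cvg; apply/cauchyP => e e0.
  pose c := 4 * K * K / `|b i| + 1.
  have c0 : 0 < c by rewrite ltr_wpDl// divr_ge0// !mulr_ge0.
  have [n0 n0P] := harm_small (e / c) (divr_gt0 e0 c0).
  exists (a n0 i); exists n0 => // m /= n0m.
  have bi0 : 0 < `|b i| by rewrite normr_gt0 bK.1.
  rewrite -ball_normE /= -(ltr_pM2r bi0).
  have := basic_coefficient_bound (fun i => a n0 i - a m i) (ltnSn i).
  move=> /le_lt_trans; apply; rewrite combinationB.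
  set h : R := n0.+1%:R^-1.
  have hm : m.+1%:R^-1 <= h by rewrite lef_pV2 ?posrE// ler_nat ltnS.
  have K20 : 0 <= 2 * K by rewrite mulr_ge0.
  rewrite (le_lt_trans (ler_wpM2l K20 (a_cauchy _ _ _)))//.
  have : h * c < e by rewrite -ltr_pdivlMr// n0P.
  rewrite -(ltr_pM2r bi0) => /(le_lt_trans _); apply.
  rewrite (_ : h * c * `|b i| = 2 * K * (K * (h + h)) + h * `|b i|); last first.
    by rewrite /c; field; rewrite gt_eqF.
  rewrite (le_trans (_ : _ <= 2 * K * (K * (h + h))))//.
    by rewrite ler_wpM2l// ler_wpM2l// lerD2l.
  by rewrite lerDl mulr_ge0// invr_ge0.
have [l lP] := choice acvg.
exists l.
have lim_close n p : `|combination b l p - combination b (a n) p| <= 2 * K * n.+1%:R^-1.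
  apply/ler_addgt0Pr => e e0.
  have /cvgrPdist_lt/(_ e e0)[m0 _ m0P] := combination_cvg (n := p) lP.
  set m := maxn n m0.
  have := m0P m (leq_maxr _ _); have := a_cauchy m n p.
  have : m.+1%:R^-1 <= n.+1%:R^-1 :> R.
    by rewrite lef_pV2 ?posrE// ler_nat ltnS leq_maxl.
  move=> mn le1 /= le2.
  rewrite -[X in X - _](subrK (combination b (a m) p)) -addrA.
  rewrite (le_trans (ler_normD _ _))// [leRHS]addrC lerD//; first by rewrite ltW.
  rewrite (le_trans le1)// (_ : 2 * K * _ = K * (n.+1%:R^-1 + n.+1%:R^-1)); last by ring.
  by rewrite ler_wpM2l// lerD2r.
apply/cvgrPdist_lt => e e0.
have K1 : 0 < 2 * K + 1 by rewrite ltr_wpDl// mulr_ge0.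
have [n nP] := harm_small (e / (2 * K + 1)) (divr_gt0 e0 K1).
exists (N n) => // p /= Np.
rewrite -[X in X - _](subrK (combination b (a n) p)) -addrA.
rewrite (le_lt_trans (ler_normD _ _))//.
have := yx n p Np; have := lim_close n p; rewrite distrC.
have := nP n (leqnn n); rewrite ltr_pdivlMr//.
move: (_^-1) => h; lra.
Qed.

Lemma basic_expansion_unique (y : X) (a a' : nat -> R) :
  combination b a n @[n --> \oo] --> y -> combination b a' n @[n --> \oo] --> y ->
  a = a'.
Proof.
move=> ay a'y; apply/funext => i; apply/eqP; rewrite -subr_eq0 -normr_le0.
have bi0 : 0 < `|b i| by rewrite normr_gt0 bK.1.
rewrite -(pmulr_lle0 _ bi0); apply/ler_addgt0Pr => e e0; rewrite add0r.
have K20 : 0 < 2 * K + 1 by rewrite ltr_wpDl// mulr_ge0.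
have e20 : 0 < e / (2 * K + 1) / 2 by rewrite !divr_gt0.
have /cvgrPdist_lt/(_ _ e20)[n1 _ n1P] := ay.
have /cvgrPdist_lt/(_ _ e20)[n2 _ n2P] := a'y.
set n := maxn i.+1 (maxn n1 n2).
have ltin : (i < n)%N by rewrite leq_max ltnSn.
have := basic_coefficient_bound (fun i => a i - a' i) ltin.
move=> /le_trans; apply; rewrite combinationB.
have := n1P n; have := n2P n; rewrite /= !leq_max !leqnn !orbT.
move=> /(_ isT) le2 /(_ isT) le1.
have le3 : `|combination b a n - combination b a' n| <= e / (2 * K + 1).
  rewrite -[X in X - _](subrK y) -addrA (le_trans (ler_normD _ _))// distrC.
  by rewrite [leRHS]splitr lerD// ltW.
rewrite (le_trans (ler_wpM2r _ (_ : 2 * K <= 2 * K + 1)))// ?lerDl//.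
by rewrite mulrC -ler_pdivlMr.
Qed.

(** Grunblum's criterion: a sequence of nonzero vectors whose partial sum
    projections are uniformly bounded is a Schauder basis of its closed span. *)
Lemma basic_sequence_schauder : exists e : nat -> linsub closed_span,
  schauder_basis e.
Proof.
have bS i : b i \in closed_span.
  rewrite (_ : b i = combination b (fun j => (j == i)%:R) i.+1) ?mem_closed_span//.
  rewrite combinationS eqxx scale1r /combination big1 ?add0r// => j _.
  by rewrite ltn_eqF ?scale0r.
exists (fun i => Sub (b i) (bS i)) => x.
have seriesE (a : nat -> R) n :
    val (series (fun n => a n *: (Sub (b n) (bS n) : linsub closed_span)) n) =
    combination b a n.
  rewrite /series/= linsub_val_sum big_mkord; apply: eq_bigr => i _.
  by rewrite linsub_valZ SubK.
pose partial (a : nat -> R) : nat -> linsub closed_span :=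
  series (fun n => a n *: (Sub (b n) (bS n) : linsub closed_span)).
have cvgE (a : nat -> R) :
    partial a @ \oo --> x <-> (combination b a n @[n --> \oo] --> val x).
  have distE n : `|x - partial a n| = `|val x - combination b a n|.
    by rewrite linsub_normE -seriesE; congr (`| _ |); exact: raddfB.
  by split=> /cvgrPdist_lt H; apply/cvgrPdist_lt => e /H; apply: filterS => n;
    rewrite distE.
have [a aP] : exists a : nat -> R, combination b a n @[n --> \oo] --> val x.
  apply: basic_expansion; rewrite -closed_spanE; exact: valP.
exists a; split; first exact/cvgE.
by move=> a' /cvgE a'P; exact: basic_expansion_unique aP a'P.
Qed.

End basic_sequences.

(** * Pairing L_1 with bounded functions *)

Section L1_pairing.
Context d (T : measurableType d) (R : realType).
Variable mu : {measure set T -> \bar R}.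
Local Notation L1 := (LspaceType1 mu).
Local Notation p1 := (@lexx _ _ (1%E : \bar R)).
Local Notation integ h := (mu.-integrable setT (EFin \o h)).
Local Notation int h := (Rintegral mu setT h).
Implicit Types (f : L1) (h g : T -> R) (c : R).

Definition bounded_measurable c h := measurable_fun setT h /\ forall x, `|h x| <= c.

Lemma bounded_measurableN c h : bounded_measurable c h ->
  bounded_measurable c (fun x => - h x).
Proof. by move=> [mh hc]; split=> [|x]; [exact: measurable_funN|rewrite normrN]. Qed.

Lemma bounded_measurableD c c' h g : bounded_measurable c h ->
  bounded_measurable c' g -> bounded_measurable (c + c') (fun x => h x + g x).
Proof.
move=> [mh hc] [mg gc']; split=> [|x]; first exact: measurable_funD.
by rewrite (le_trans (ler_normD _ _))// lerD.
Qed.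

Lemma bounded_measurableM c c' h g : bounded_measurable c h ->
  bounded_measurable c' g -> bounded_measurable (c * c') (fun x => h x * g x).
Proof.
move=> [mh hc] [mg gc']; split=> [|x]; first exact: measurable_funM.
by rewrite normrM ler_pM.
Qed.

Lemma bounded_measurable_cst c : bounded_measurable `|c| (fun=> c).
Proof. by split. Qed.

Lemma bounded_measurable_indic (A : set T) : measurable A ->
  bounded_measurable 1 (\1_A : T -> R).
Proof.
move=> mA; split=> [|x]; first exact: measurable_indic.
by rewrite indicE; case: (_ \in _); rewrite ?normr1 ?normr0.
Qed.

Definition sign_of h (x : T) : R := if 0 <= h x then 1 else -1.

Lemma sign_ofM h x : sign_of h x * h x = `|h x|.
Proof.
rewrite /sign_of; case: (leP 0 (h x)) => [h0|h0]; first by rewrite mul1r ger0_norm.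
by rewrite mulN1r ltr0_norm.
Qed.

Lemma bounded_measurable_sign h : measurable_fun setT h ->
  bounded_measurable 1 (sign_of h).
Proof.
move=> mh; split=> [|x]; last first.
  by rewrite /sign_of; case: ifP; rewrite ?normrN normr1.
have mA : measurable [set x | 0 <= h x].
  rewrite (_ : [set x | _] = setT `&` h @^-1` `[0, +oo[); first exact: mh.
  by apply/seteqP; split=> x /=; rewrite in_itv/= andbT// => -[].
rewrite (_ : sign_of h = fun x => 2 * \1_[set x | 0 <= h x] x - 1).
  by apply: measurable_funB => //; apply: measurable_funM.
apply/funext => x; rewrite /sign_of indicE; case: ifPn => h0.
  by rewrite mem_set//= mulr1 -addrA subrr addr0.
by rewrite memNset ?mulr0 ?sub0r//; exact/negP.
Qed.

Let bounded_ext c h : (forall x, `|h x| <= c) -> [bounded h x | x in setT].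
Proof.
move=> hc; exists c; split; first exact: num_real.
by move=> M cM x _ /=; rewrite (le_trans (hc x))// ltW.
Qed.

Lemma integrableM_bounded h g c : integ h -> bounded_measurable c g ->
  integ (fun x => h x * g x).
Proof. by move=> ih [mg /bounded_ext gc]; exact: (integrableMl _ ih mg gc). Qed.

Lemma L1_integrable f : integ f.
Proof. exact/Lfun1_integrable/L1_Lfun. Qed.

Lemma L1_measurable f : measurable_fun setT (f : T -> R).
Proof. exact/measurable_EFinP/(measurable_int _ (L1_integrable f)). Qed.

Lemma Rintegral_ae h g : measurable_fun setT h -> measurable_fun setT g ->
  h = g %[ae mu] -> int h = int g.
Proof.
move=> mh mg hg; congr fine; apply: ae_eq_integral => //; first exact/measurable_EFinP.
  exact/measurable_EFinP.
by apply: filterS hg => x /= /[apply] ->.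
Qed.

(** The class of [h], for integrable [h]; the value 0 is a default. *)
Definition L1_of h : L1 :=
  match pselect (h \in Lfun mu 1%E) with
  | left hL => L1_class (Lfun_Sub p1 hL)
  | right _ => 0
  end.

Lemma L1_ofE h : integ h -> (L1_of h : T -> R) = h %[ae mu].
Proof.
move=> /Lfun1_integrable hL; rewrite /L1_of; case: pselect => // hL'.
exact: L1_classE.
Qed.

Lemma L1_addE f f' : (f + f' : L1) = (fun x => f x + f' x) %[ae mu].
Proof. exact: (L1_classE (L1_repr f + L1_repr f')). Qed.

Lemma L1_scaleE c f : (c *: f : L1) = (fun x => c * f x) %[ae mu].
Proof. exact: (L1_classE (c *: L1_repr f)). Qed.

Lemma L1_norm_int f : `|f| = int (fun x => `|f x|).
Proof. by rewrite /Rintegral -[LHS]/(fine `|f|%:E) L1_normE. Qed.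

Lemma L1_of_norm h : integ h -> `|L1_of h| = int (fun x => `|h x|).
Proof.
move=> ih; rewrite L1_norm_int; apply: Rintegral_ae.
- by apply: measurableT_comp => //; exact: L1_measurable.
- apply: measurableT_comp => //; exact/measurable_EFinP/(measurable_int _ ih).
- by apply: filterS (L1_ofE ih) => x /= /[apply] ->.
Qed.

Lemma L1_of_lin a h g : integ h -> integ g ->
  L1_of (fun x => a * h x + g x) = a *: L1_of h + L1_of g.
Proof.
move=> ih ig; apply: L1_ae_eq.
have iahg : integ (fun x => a * h x + g x).
  exact: (integrableD measurableT (integrableZl measurableT a ih) ig).
apply: ae_eq_trans (L1_ofE iahg) _; apply/ae_eq_sym.
apply: ae_eq_trans (L1_addE _ _) _.
apply: filterS3 (L1_scaleE a (L1_of h)) (L1_ofE ih) (L1_ofE ig).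
by move=> x /= E1 E2 E3 xT; rewrite E1// E2// E3.
Qed.

Lemma L1_of0 : L1_of (fun=> 0) = 0.
Proof.
apply: L1_ae_eq; apply: ae_eq_trans (L1_ofE _) _.
  exact: (integrable0 mu (setT : set T)).
exact: ae_eq_sym (L1_classE 0).
Qed.

Lemma L1_ofZ a h : integ h -> L1_of (fun x => a * h x) = a *: L1_of h.
Proof.
move=> ih; rewrite -[RHS]addr0 -L1_of0 -L1_of_lin//.
  by congr L1_of; apply/funext => x; rewrite addr0.
exact: (integrable0 mu (setT : set T)).
Qed.

Lemma L1_of_id f : L1_of f = f.
Proof. by apply: L1_ae_eq; exact: L1_ofE (L1_integrable f). Qed.

Definition pairing f g := int (fun x => f x * g x).

Lemma pairing_of h g c : integ h -> bounded_measurable c g ->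
  pairing (L1_of h) g = int (fun x => h x * g x).
Proof.
move=> ih [mg gc]; apply: Rintegral_ae.
- by apply: measurable_funM => //; exact: L1_measurable.
- apply: measurable_funM => //; exact/measurable_EFinP/(measurable_int _ ih).
- by apply: filterS (L1_ofE ih) => x /= /[apply] ->.
Qed.

Lemma pairing_lin c g a f f' : bounded_measurable c g ->
  pairing (a *: f + f') g = a * pairing f g + pairing f' g.
Proof.
move=> gb; have [mg gc] := gb.
have ifg f0 : integ (fun x => f0 x * g x).
  exact: integrableM_bounded (L1_integrable f0) gb.
have -> : pairing (a *: f + f') g =
    int (fun x => a * (f x * g x) + f' x * g x).
  apply: Rintegral_ae.
  - by apply: measurable_funM => //; exact: L1_measurable.
  - apply: measurable_funD; last by apply: measurable_funM => //; exact: L1_measurable.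
    apply: measurable_funM => //; apply: measurable_funM => //; exact: L1_measurable.
  - apply: filterS2 (L1_addE (a *: f) f') (L1_scaleE a f) => x /= E1 E2 xT.
    by rewrite E1// E2// mulrDl mulrA.
rewrite RintegralD//; last exact: (integrableZl measurableT a (ifg f)).
by rewrite RintegralZl.
Qed.

Lemma pairingD f c g c' g' : bounded_measurable c g -> bounded_measurable c' g' ->
  pairing f (fun x => g x + g' x) = pairing f g + pairing f g'.
Proof.
move=> gb gb'; rewrite /pairing -RintegralD//.
- by apply: eq_Rintegral => x _; rewrite mulrDr.
- exact: integrableM_bounded (L1_integrable f) gb.
- exact: integrableM_bounded (L1_integrable f) gb'.
Qed.

Lemma pairing_le f c g : bounded_measurable c g -> `|pairing f g| <= c * `|f|.
Proof.
move=> gb; have [mg gc] := gb.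
have ifg := integrableM_bounded (L1_integrable f) gb.
have inf := integrable_norm (L1_integrable f).
rewrite (le_trans (le_normr_Rintegral _ ifg))// L1_norm_int -RintegralZl//.
apply: le_Rintegral => //.
- exact: (integrable_norm ifg).
- exact: (integrableZl measurableT c inf).
- by move=> x _; rewrite normrM mulrC ler_wpM2r.
Qed.

Lemma pairing_functional c g : bounded_measurable c g ->
  exists phi : {linear L1 -> R^o}, bounded_fun_norm phi /\ forall f, phi f = pairing f g.
Proof.
move=> gb.
have plin : linear ((fun f => pairing f g) : L1 -> R^o).
  by move=> a f f'; rewrite (pairing_lin _ _ _ gb).
pose lp := GRing.isLinear.Build _ _ _ _ ((fun f => pairing f g) : L1 -> R^o) plin.
pose phi : {linear L1 -> R^o} := HB.pack ((fun f => pairing f g) : L1 -> R^o) lp.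
exists phi; split=> // r; exists (`|c| * r) => f fr.
rewrite (le_trans (pairing_le f gb))// (le_trans (ler_norm _))// normrM normr_id.
by rewrite ler_wpM2l.
Qed.

Lemma weakly_cvg_pairing (u : nat -> L1) l c g : weakly_cvg u l ->
  bounded_measurable c g -> pairing (u n - l) g @[n --> \oo] --> 0.
Proof.
move=> ul gb; have [phi [phib phiE]] := pairing_functional gb.
have := ul _ phib => /cvgrPdist_lt H; apply/cvgrPdist_lt => e /H.
apply: filterS => n /=.
by rewrite sub0r normrN -phiE linearB distrC.
Qed.

End L1_pairing.

(** * Equi-integrability of weakly null sequences *)

Section weakly_null_equiintegrable.
Context d (T : measurableType d) (R : realType).
Variable mu : {measure set T -> \bar R}.
Local Notation L1 := (LspaceType1 mu).
Implicit Types (f : L1) (g : T -> R) (A : set T).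

Definition mass f A : R := \int[mu]_(x in A) `|f x|.

Lemma mass_indic f A : mass f A = \int[mu]_x (`|f x| * \1_A x).
Proof. by rewrite /mass Rintegral_mkcond patch_indic. Qed.

Lemma mass_pairing f A : mass f A = pairing f (fun x => sign_of f x * \1_A x).
Proof.
rewrite mass_indic; apply: eq_Rintegral => x _.
by rewrite mulrA [X in _ = X * _]mulrC sign_ofM.
Qed.

Lemma mass_continuous f e : 0 < e -> exists2 r : R, 0 < r &
  forall A, measurable A -> (mu A < r%:E)%E -> mass f A < e.
Proof.
by move=> e0; have [r [r0 rP]] := integral_normr_continuous (L1_integrable f) e0;
  exists r.
Qed.

Lemma mass_le_norm f A : measurable A -> mass f A <= `|f|.
Proof.
move=> mA; have A1 := bounded_measurable_indic R mA.
have s1 := bounded_measurable_sign (L1_measurable f).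
rewrite mass_pairing (le_trans (ler_norm _))//.
by have := pairing_le f (bounded_measurableM s1 A1); rewrite !mul1r.
Qed.

Lemma pairing_dist f g g' (c : R) A : measurable A ->
  bounded_measurable c g -> bounded_measurable c g' ->
  (forall x, ~ A x -> g x = g' x) ->
  `|pairing f g - pairing f g'| <= 2 * c * mass f A.
Proof.
move=> mA gb gb' gg'.
have iM := integrableM_bounded (L1_integrable f).
rewrite -RintegralB//; [|exact: iM gb|exact: iM gb'].
have hb : bounded_measurable (c + c) (fun x => g x - g' x).
  exact: bounded_measurableD gb (bounded_measurableN gb').
have iA : mu.-integrable setT (EFin \o (fun x => `|f x| * \1_A x)).
  have iN := integrable_norm (L1_integrable f).
  exact: (integrableM_bounded iN (bounded_measurable_indic R mA)).
rewrite mass_indic -RintegralZl//.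
have -> : \int[mu]_t (f t * g t - f t * g' t) = \int[mu]_t (f t * (g t - g' t)).
  by apply: eq_Rintegral => x _; rewrite mulrBr.
have ih : mu.-integrable setT (EFin \o (fun x => f x * (g x - g' x))) by exact: iM hb.
rewrite (le_trans (le_normr_Rintegral _ ih))//; apply: le_Rintegral => //.
- exact: (integrable_norm ih).
- exact: (integrableZl measurableT (2 * c) iA).
move=> x _; rewrite normrM indicE.
have [Ax|nAx] := pselect (A x).
  rewrite mem_set// mulr1 mulrC ler_wpM2r// mulr_natl mulr2n; exact: hb.2.
by rewrite memNset// gg'// subrr normr0 !mulr0.
Qed.

Variable u : nat -> L1.
Hypothesis u_null : forall c g, bounded_measurable c g ->
  pairing (u n) g @[n --> \oo] --> 0.

Let ball_sum1 g s A : measurable A -> bounded_measurable 1 g ->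
  bounded_measurable 1 s ->
  bounded_measurable 1 (fun x => g x + (s x - g x) * \1_A x).
Proof.
move=> mA [mg g1] [ms s1]; split=> [|x].
  apply: measurable_funD => //; apply: measurable_funM; last exact: measurable_indic.
  exact: measurable_funB.
rewrite indicE; case: (x \in A); first by rewrite mulr1 addrC subrK.
by rewrite mulr0 addr0.
Qed.

Record hump := Hump { hump_fun : T -> R; hump_index : nat;
  hump_tol : R; hump_set : set T }.

(** One step of the gliding hump: some later [u n] has a mass larger than [e] on a
    set below the current tolerance.  Modifying the function there makes its
    pairing with [u n] large, and the next tolerance is so small that later
    modifications cannot undo it. *)
Let hump_step e (s s' : hump) :=
  [/\ measurable (hump_set s') /\ (mu (hump_set s') < (hump_tol s)%:E)%E,
      (forall x, ~ hump_set s' x -> hump_fun s' x = hump_fun s x),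
      (hump_index s < hump_index s')%N /\ hump_tol s' <= hump_tol s / 2,
      3 / 8 * e <= `|pairing (u (hump_index s')) (hump_fun s')|
    & forall A, measurable A -> (mu A < (3 * hump_tol s')%:E)%E ->
      mass (u (hump_index s')) A < e / 16].

Let hump_inv (s : hump) := bounded_measurable 1 (hump_fun s) /\ 0 < hump_tol s.

(** On the small set, the function is replaced either by the sign of [u n] or by 0:
    if its own pairing with [u n] over the set is at most [e / 2], the first
    choice raises the pairing by at least [e / 2], otherwise the second lowers it
    by at least [e / 2]. *)
Let hump_exists e (s : hump) : 0 < e -> hump_inv s ->
  (forall r, 0 < r -> exists n A, [/\ measurable A, (mu A < r%:E)%E & e < mass (u n) A]) ->
  exists s', hump_inv s' /\ hump_step e s s'.
Proof.
case: s => g N r B /= e0 [/= g1 r0] H.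
have [N1 _ N1P] : \forall n \near \oo, `|pairing (u n) g| < e / 8.
  have /cvgrPdist_lt/(_ (e / 8)) := u_null g1; rewrite divr_gt0// => /(_ isT).
  by apply: filterS => n; rewrite sub0r normrN.
set M := maxn N.+1 N1.
have [r1 r10 r1P] : exists2 r1 : R, 0 < r1 & forall n, (n < M)%N ->
    forall A, measurable A -> (mu A < r1%:E)%E -> mass (u n) A < e.
  elim: M => [|M [r1 r10 r1P]]; first by exists 1.
  have [r2 r20 r2P] := mass_continuous (u M) e0.
  exists (Num.min r1 r2) => [|n]; first by rewrite lt_min r10.
  rewrite ltnS leq_eqVlt => nM A mA.
  rewrite EFin_min lt_min => /andP[A1 A2].
  by case/orP: nM => [/eqP ->|nM]; [exact: r2P|exact: r1P].
have [|n [A [mA Ar eA]]] := H (Num.min r r1); first by rewrite lt_min r0.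
move: Ar; rewrite EFin_min lt_min => /andP[Ar Ar1].
have Mn : (M <= n)%N.
  rewrite leqNgt; apply/negP => nM; have := r1P n nM A mA Ar1.
  by rewrite ltNge (ltW eA).
have [rn rn0 rnP] : exists2 r0 : R, 0 < r0 & forall A, measurable A ->
    (mu A < r0%:E)%E -> mass (u n) A < e / 16.
  by apply: mass_continuous; rewrite divr_gt0.
have A1 := bounded_measurable_indic R mA.
have gA := bounded_measurableM g1 A1.
have sA : bounded_measurable 1 (sign_of (u n)).
  exact/bounded_measurable_sign/L1_measurable.
have s0 : bounded_measurable 1 (fun=> 0 : R) by split=> // x; rewrite normr0.
pose p := pairing (u n) (fun x => g x * \1_A x).
have pD s : bounded_measurable 1 s ->
    pairing (u n) (fun x => g x + (s x - g x) * \1_A x) =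
    pairing (u n) g + (pairing (u n) (fun x => s x * \1_A x) - p).
  move=> s1; have sA1 := bounded_measurableM s1 A1.
  have D1 := bounded_measurableD sA1 (bounded_measurableN gA).
  transitivity (pairing (u n) (fun x => g x + (s x * \1_A x + - (g x * \1_A x)))).
    by apply: eq_Rintegral => x _; rewrite mulrBl.
  rewrite (pairingD _ g1 D1) (pairingD _ sA1 (bounded_measurableN gA)).
  congr (_ + (_ + _)); rewrite -[RHS]mulN1r -RintegralZl//.
    by apply: eq_Rintegral => x _; rewrite mulN1r mulrN.
  exact: integrableM_bounded (L1_integrable _) gA.
have small : `|pairing (u n) g| < e / 8.
  by apply: N1P => /=; rewrite (leq_trans _ Mn)// leq_maxr.
have [s [s1 sP]] : exists s, bounded_measurable 1 s /\
    3 / 8 * e <= `|pairing (u n) (fun x => g x + (s x - g x) * \1_A x)|.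
  have [pe|pe] := leP p (e / 2).
    exists (sign_of (u n)); split=> //; rewrite pD// -mass_pairing.
    move: small; rewrite ltr_norml => /andP[small _].
    by rewrite (le_trans _ (ler_norm _))//; lra.
  exists (fun=> 0); split=> //; rewrite pD//.
  have -> : pairing (u n) (fun x => 0 * \1_A x) = 0.
    rewrite -[RHS](mul0r (fine (mu setT))) -Rintegral_cst//.
    by apply: eq_Rintegral => x _; rewrite mul0r mulr0.
  move: small; rewrite ltr_norml => /andP[_ small].
  by rewrite -normrN (le_trans _ (ler_norm _))//; lra.
exists (Hump (fun x => g x + (s x - g x) * \1_A x) n (Num.min (r / 2) (rn / 3)) A).
split; first by split; [exact: ball_sum1|rewrite /= lt_min !divr_gt0].
split=> //=.
- by move=> x nA; rewrite indicE memNset// mulr0 addr0.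
- by rewrite ge_min lexx; split=> //; rewrite (leq_trans _ Mn)// leq_maxl.
- move=> B' mB' B's; apply: rnP => //; rewrite (lt_le_trans B's)// lee_fin.
  by rewrite mulrC -ler_pdivlMr// ge_min lexx orbT.
Qed.

(** The gliding hump argument behind the Dunford-Pettis criterion: if the masses
    of the [u n] were not uniformly small on small sets, a bounded function
    whose pairing with the [u n] does not tend to 0 could be built piece by
    piece. *)
Lemma weakly_null_equi_continuous e : 0 < e -> exists2 r : R, 0 < r &
  forall n A, measurable A -> (mu A < r%:E)%E -> mass (u n) A <= e.
Proof.
move=> e0; apply: contrapT => nH.
have H r : 0 < r -> exists n A, [/\ measurable A, (mu A < r%:E)%E & e < mass (u n) A].
  move=> r0; apply: contrapT => nA; apply: nH; exists r => // n A mA Ar.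
  by rewrite leNgt; apply/negP => eA; apply: nA; exists n, A.
have inv0 : hump_inv (Hump (fun=> 0) 0 1 set0).
  by split=> //=; split=> // x; rewrite normr0.
have step (s : {s | hump_inv s}) : {s' : {s | hump_inv s} | hump_step e (sval s) (sval s')}.
  by apply: cid; have [s' [si ss']] := hump_exists e0 (svalP s) H; exists (exist _ s' si).
have [s_ [_ s_step]] := dependent_choice step (exist _ _ inv0).
pose g k := hump_fun (sval (s_ k)); pose n k := hump_index (sval (s_ k)).
pose r k := hump_tol (sval (s_ k)); pose A k := hump_set (sval (s_ k.+1)).
have g1 k : bounded_measurable 1 (g k) by exact: (svalP (s_ k)).1.
have r0 k : 0 < r k by exact: (svalP (s_ k)).2.
have mA k : measurable (A k) by have [[]] := s_step k.
have rD k j : r (k + j)%N <= r k / 2 ^+ j.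
  elim: j => [|j IH]; first by rewrite addn0 expr0 divr1.
  have [_ _ [_ r2] _ _] := s_step (k + j)%N; rewrite addnS (le_trans r2)//.
  by rewrite exprSr invfM mulrA ler_wpM2r.
pose E k := \bigcup_j A (k + j)%N.
have mE k : measurable (E k) by apply: bigcup_measurable => j _; exact: mA.
have muE k : (mu (E k) < (3 * r k)%:E)%E.
  apply: (@le_lt_trans _ _ (2 * r k)%:E); last by rewrite lte_fin ltr_pM2r// ltr_nat.
  have r20 : 0 <= 2 * r k by rewrite mulr_ge0// ltW.
  apply: le_trans (epsilon_trick0 xpredT r20).
  have sub : E k `<=` \bigcup_j A (k + j)%N by [].
  apply: (le_trans (measure_sigma_subadditive mu (fun j => mA (k + j)%N) (mE k) sub)).
  apply: lee_nneseries => // j _.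
  have [[_ Ar] _ _ _ _] := s_step (k + j)%N; rewrite (le_trans (ltW Ar))// lee_fin.
  rewrite (le_trans (rD k j))// expnS natrM natrX invfM mulrACA divff ?mul1r//.
have gE k j x : ~ E k x -> g (k + j)%N x = g k x.
  move=> nE; elim: j => [|j IH]; first by rewrite addn0.
  have [_ gA _ _ _] := s_step (k + j)%N; rewrite addnS -IH; apply: gA => Ax.
  by apply: nE; exists j.
(* The modifications stop at almost every point; the clamping only serves at the
   other points. *)
pose G x := Num.max (-1) (Num.min 1 (limn_sup (fun k => g k x))).
have G1 : bounded_measurable 1 G.
  split=> [|x]; last first.
    by rewrite ler_norml /G le_max lexx/= ge_max ge_min lexx andbT; lra.
  apply: measurable_maxr => //; apply: measurable_minr => //.
  apply: (measurable_fun_limn_sup (h := g)) => [x _|x _|k].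
  - by exists 1 => _ [k _ <-]; rewrite (le_trans (ler_norm _))// (g1 k).2.
  - by exists (-1) => _ [k _ <-]; have := (g1 k).2 x; rewrite ler_norml => /andP[].
  - exact: (g1 k).1.
have GE k x : ~ E k x -> G x = g k x.
  move=> nE; have gk : g ^~ x @ \oo --> g k x.
    apply: cvg_near_cst; exists k => // j /= kj; rewrite -(subnKC kj); exact: gE.
  rewrite /G cvg_limn_supE; last by apply/cvg_ex; exists (g k x).
  rewrite (cvg_lim _ gk)//; have := (g1 k).2 x; rewrite ler_norml => /andP[l1 l2].
  by rewrite (min_idPr l2) (max_idPr l1).
have nk k : (k <= n k)%N.
  elim: k => // k IH; have [_ _ [nn _] _ _] := s_step k.
  exact: leq_ltn_trans IH nn.
have big k : e / 4 <= `|pairing (u (n k.+1)) G|.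
  have [_ _ _ low small] := s_step k; rewrite -/(n k.+1) -/(g k.+1) in low small.
  have := pairing_dist (u (n k.+1)) (mE k.+1) (g1 k.+1) G1 (fun x nE => esym (GE _ x nE)).
  have := small _ (mE k.+1) (muE k.+1).
  have := ler_normB (pairing (u (n k.+1)) (g k.+1) - pairing (u (n k.+1)) G)
    (- pairing (u (n k.+1)) G).
  rewrite opprK subrK normrN; lra.
have /cvgrPdist_lt/(_ (e / 4)) := u_null G1.
rewrite divr_gt0// => /(_ isT)[N _ NP].
have := NP (n N.+1) (leq_trans (leqnSn N) (nk N.+1)).
by rewrite sub0r normrN ltNge big.
Qed.

End weakly_null_equiintegrable.

(** * Dyadic step functions on the unit interval *)

Section unit_interval.
Context (R : realType).
Local Notation mu :=
  (mrestr (@lebesgue_measure R) (measurable_itv `[0%R, 1%R])).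
Local Notation L1 := (L1_01 R).
Implicit Types (f : L1) (h g : R -> R).

Definition dyadic (n i : nat) : set (measurableTypeR R) :=
  `[i%:R / 2 ^+ n, i.+1%:R / 2 ^+ n[%classic.

Let pow2_gt0 n : 0 < 2 ^+ n :> R. Proof. exact: exprn_gt0. Qed.

Lemma measurable_dyadic n i : measurable (dyadic n i). Proof. exact: measurable_itv. Qed.

Lemma dyadicP n i x : dyadic n i x <-> i%:R <= 2 ^+ n * x < i.+1%:R.
Proof.
rewrite /dyadic/= in_itv/= ler_pdivrMr// ltr_pdivlMr// ![_ * 2 ^+ n]mulrC.
by [].
Qed.

Lemma dyadic_split n i :
  dyadic n i = dyadic n.+1 i.*2 `|` dyadic n.+1 i.*2.+1.
Proof.
have half k x : (k.*2%:R <= 2 ^+ n.+1 * x) = (k%:R <= 2 ^+ n * x :> R).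
  by rewrite exprS -mulrA -mul2n natrM ler_pM2l.
apply/seteqP; split=> x.
  move=> /dyadicP/andP[l1 l2].
  have [lt|le] := ltP (2 ^+ n.+1 * x) i.*2.+1%:R; [left|right]; apply/dyadicP.
    by rewrite lt half l1.
  by rewrite le /= -doubleS ltNge half -ltNge.
move=> [|] /dyadicP/andP[l1 l2]; apply/dyadicP; rewrite -half ltNge -half -ltNge doubleS.
  by rewrite l1 (lt_trans l2)// ltr_nat.
by rewrite l2 andbT (le_trans _ l1)// ler_nat.
Qed.

Lemma dyadic_disjoint n i j : i != j -> dyadic n i `&` dyadic n j = set0.
Proof.
move=> ij; apply/seteqP; split=> // x [/dyadicP/andP[i1 i2] /dyadicP/andP[j1 j2]].
have := le_lt_trans i1 j2; have := le_lt_trans j1 i2.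
by rewrite !ltr_nat !ltnS => ji ij'; move: ij; rewrite eqn_leq ij' ji.
Qed.

Lemma measure_dyadic n i : (i < 2 ^ n)%N -> mu (dyadic n i) = (2 ^- n)%:E.
Proof.
move=> i2n.
have sub : dyadic n i `<=` `[0, 1]%classic.
  move=> x /dyadicP/andP[l1 l2]; rewrite /= in_itv/=; apply/andP; split.
    by rewrite -(pmulr_rge0 _ (pow2_gt0 n)) (le_trans _ l1).
  rewrite -(ler_pM2l (pow2_gt0 n)) mulr1 (le_trans (ltW l2))//.
  by rewrite -natrX ler_nat.
rewrite /= /mrestr setIidl// lebesgue_measure_itv/= lte_fin ltr_pM2r ?invr_gt0//.
rewrite ltr_nat ltnSn -EFinB -mulrBl.
by rewrite -natrB// subSnn mul1r.
Qed.

Lemma measure_unit_interval : mu setT = 1%E.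
Proof. by rewrite /= /mrestr setTI lebesgue_measure_itv/= lte01 oppr0 adde0. Qed.

Lemma measure_unit_complement : mu (~` dyadic 0 0) = 0%E.
Proof.
rewrite /= /mrestr (_ : _ `&` _ = [set 1]) ?lebesgue_measure_set1//.
apply/seteqP; split=> x /=.
  rewrite in_itv/= => -[nD /andP[x0 x1]]; apply/eqP; rewrite eq_le x1/= leNgt.
  by apply/negP => x1'; apply: nD; apply/dyadicP; rewrite expr0 mul1r x0.
move=> ->; rewrite in_itv/= ler01 lexx; split=> // /dyadicP.
by rewrite expr0 mul1r ltxx andbF.
Qed.

Lemma mass_dyadic_split f n i :
  mass f (dyadic n i) = mass f (dyadic n.+1 i.*2) + mass f (dyadic n.+1 i.*2.+1).
Proof.
rewrite /mass dyadic_split Rintegral_setU//; try exact: measurable_dyadic.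
- apply: (integrableS measurableT) => //; last exact: (integrable_norm (L1_integrable f)).
  by apply: measurableU; exact: measurable_dyadic.
- by apply/disj_setPS; rewrite dyadic_disjoint // neq_ltn leqnn.
Qed.

Lemma mass_unit f : mass f (dyadic 0 0) = `|f|.
Proof.
apply/eqP; rewrite eq_sym eq_le; apply/andP; split.
  apply/ler_addgt0Pr => e e0.
  have [r r0 rP] := mass_continuous f e0.
  have mC := measurableC (measurable_dyadic 0 0).
  have small : mass f (~` dyadic 0 0) < e.
    by apply: rP mC _; rewrite [ltLHS]measure_unit_complement lte_fin.
  rewrite L1_norm_int -(setvU (dyadic 0 0)) Rintegral_setU//.
  - by rewrite addrC lerD2l ltW.
  - exact: measurable_dyadic.
  - by rewrite setvU; exact: (integrable_norm (L1_integrable f)).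
  - by apply/disj_setPS; rewrite setICl.
rewrite L1_norm_int mass_indic; apply: le_Rintegral => //.
- exact: (integrableM_bounded (integrable_norm (L1_integrable f))
    (bounded_measurable_indic R (measurable_dyadic 0 0))).
- exact: (integrable_norm (L1_integrable f)).
- by move=> x _; rewrite ler_piMr// indicE; case: (_ \in _).
Qed.

Lemma sum_double (V : nmodType) (F : nat -> V) n :
  \sum_(i < 2 ^ n.+1) F i = \sum_(i < 2 ^ n) (F i.*2 + F i.*2.+1).
Proof.
rewrite expnS mul2n; elim: (2 ^ n)%N => [|m IH]; first by rewrite !big_ord0.
by rewrite doubleS !big_ord_recr/= IH addrA.
Qed.

Lemma sum_mass_dyadic f n : \sum_(i < 2 ^ n) mass f (dyadic n i) = `|f|.
Proof.
elim: n => [|n IH]; first by rewrite expn0 big_ord1 mass_unit.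
rewrite (sum_double (fun i => mass f (dyadic n.+1 i))) -IH.
by apply: eq_bigr => i _; rewrite [RHS]mass_dyadic_split.
Qed.

Lemma bounded_integrable c h : bounded_measurable c h ->
  mu.-integrable setT (EFin \o h).
Proof.
move=> [mh hc]; apply: measurable_bounded_integrable => //.
  by rewrite [ltLHS]measure_unit_interval ltry.
exists c; split; first exact: num_real.
by move=> M cM x _ /=; rewrite (le_trans (hc x))// ltW.
Qed.

Definition cell n i : L1 := L1_of mu (\1_(dyadic n i)).

Let dyadic1 n i : bounded_measurable 1 (\1_(dyadic n i) : _ -> R).
Proof. exact: bounded_measurable_indic (measurable_dyadic n i). Qed.

Lemma cell_split n i : cell n i = cell n.+1 i.*2 + cell n.+1 i.*2.+1.
Proof.
rewrite -[cell n.+1 i.*2]scale1r -[RHS]L1_of_lin; try exact: bounded_integrable (dyadic1 _ _).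
congr (L1_of mu _); apply/funext => x; rewrite mul1r dyadic_split !indicE in_setU.
have [xA|_] := boolP (x \in dyadic n.+1 i.*2); last by rewrite add0r.
have [xB|_] := boolP (x \in dyadic n.+1 i.*2.+1); last by rewrite addr0.
have : (dyadic n.+1 i.*2 `&` dyadic n.+1 i.*2.+1) x.
  by split; exact: set_mem.
by rewrite dyadic_disjoint// neq_ltn ltnSn.
Qed.

Lemma cell_norm n i : (i < 2 ^ n)%N -> `|cell n i| = 2 ^- n.
Proof.
move=> i2n; rewrite [LHS]L1_of_norm; last exact: bounded_integrable (dyadic1 _ _).
rewrite (_ : Rintegral _ _ _ = \int[mu]_(x in dyadic n i) 1); last first.
  rewrite [RHS]Rintegral_mkcond; apply: eq_Rintegral => x _.
  by rewrite patch_indic ger0_norm//= mul1r.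
rewrite Rintegral_cst; last exact: measurable_dyadic.
by rewrite [X in _ * fine X]measure_dyadic// mul1r.
Qed.

Lemma pairing_le_mass f (A : set (measurableTypeR R)) : measurable A ->
  `|pairing f \1_A| <= mass f A.
Proof.
move=> mA; have A1 := bounded_measurable_indic R mA.
have ifA := integrableM_bounded (L1_integrable f) A1.
rewrite mass_indic (le_trans (le_normr_Rintegral _ ifA))//.
rewrite (@eq_Rintegral _ _ _ _ _ (fun x => `|f x| * \1_A x))// => x _.
by rewrite normrM [X in _ * X]ger0_norm.
Qed.

Lemma pairing_cell n i j : (i < 2 ^ n)%N ->
  pairing (cell n i) \1_(dyadic n j) = if i == j then 2 ^- n else 0.
Proof.
move=> i2n; rewrite [LHS](pairing_of (bounded_integrable (dyadic1 _ _)) (dyadic1 _ _)).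
have -> : Rintegral mu setT (fun x => \1_(dyadic n i) x * \1_(dyadic n j) x) =
    \int[mu]_(x in dyadic n i `&` dyadic n j) 1.
  rewrite [RHS]Rintegral_mkcond; apply: eq_Rintegral => x _.
  by rewrite patch_indic indicI/= mul1r.
rewrite Rintegral_cst; last by apply: measurableI; exact: measurable_dyadic.
case: eqP => [<-|/eqP ij]; first by rewrite setIid [X in _ * fine X]measure_dyadic// mul1r.
by rewrite dyadic_disjoint// measure0 mulr0.
Qed.

Definition step n (G : nat -> R) : L1 := \sum_(i < 2 ^ n) G i *: cell n i.

Lemma step_refine n G : step n G = step n.+1 (fun i => G i./2).
Proof.
rewrite /step (sum_double (fun i => G i./2 *: cell n.+1 i)); apply: eq_bigr => i _.
by rewrite cell_split scalerDr doubleK -[i.*2.+1]addn1 halfD odd_double/= addn0 doubleK.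
Qed.

Lemma step_norm n G : `|step n G| <= 2 ^- n * \sum_(i < 2 ^ n) `|G i|.
Proof.
rewrite (le_trans (ler_norm_sum _ _ _))// mulr_sumr; apply: ler_sum => i _.
by rewrite normrZ cell_norm// mulrC.
Qed.

Let step_fun n (G : nat -> R) (x : R) := \sum_(i < 2 ^ n) G i * \1_(dyadic n i) x.

Let step_funE n G : mu.-integrable setT (EFin \o step_fun n G) /\
  step n G = L1_of mu (step_fun n G).
Proof.
rewrite /step_fun /step; elim: (2 ^ n)%N => [|m [IH1 IH2]].
  have b0 : bounded_measurable 0 (fun x : measurableTypeR R =>
      \sum_(i < 0) G i * \1_(dyadic n i) x).
    rewrite (_ : (fun x => _) = fun=> 0); first by split=> // x; rewrite normr0.
    by apply/funext => x; rewrite big_ord0.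
  split; first exact: bounded_integrable b0.
  rewrite big_ord0; apply/esym/eqP; rewrite -normr_eq0 [X in X == _]L1_of_norm; last first.
    exact: bounded_integrable b0.
  rewrite (_ : Rintegral _ _ _ = \int[mu]_x 0); first by rewrite Rintegral_cst ?mul0r.
  by apply: eq_Rintegral => x _; rewrite big_ord0 normr0.
have sumE : (fun x => \sum_(i < m.+1) G i * \1_(dyadic n i) x) =
    (fun x => G m * \1_(dyadic n m) x + \sum_(i < m) G i * \1_(dyadic n i) x).
  by apply/funext => x; rewrite big_ord_recr/= addrC.
have im := bounded_integrable (dyadic1 n m).
rewrite sumE; split.
  exact: (integrableD measurableT (integrableZl measurableT (G m) im) IH1).
by rewrite big_ord_recr/= IH2 addrC [RHS]L1_of_lin.
Qed.

(** The restricted measure and the Lebesgue measure agree inside [0, 1], and the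
    former does not charge the complement. *)
Lemma unit_integral (h : R -> \bar R) : (forall x, 0 <= h x)%E ->
  measurable_fun (setT : set (measurableTypeR R)) h ->
  (\int[mu]_x h x = \int[@lebesgue_measure R]_(x in `[0%R, 1%R]) h x)%E.
Proof.
move=> h0 mh; have mI := measurable_itv `[0 : R, 1].
pose C : set (measurableTypeR R) := ~` `[0, 1]%classic.
have nullC : mu C = 0%E by rewrite /= /mrestr setICl measure0.
rewrite [LHS](@ge0_negligible_integral _ _ _ _ setT C) ; try by [];
  try exact: (measurableC mI); try exact: nullC.
rewrite setTD /C setCK; apply: eq_measure_integral => A mA AI.
by rewrite /= /mrestr setIidl.
Qed.

Let uniform_modulus (g : R -> R) e : continuous g -> 0 < e -> exists n : nat,
  forall x y, 0 <= x <= 1 -> `|x - y| < n.+1%:R^-1 -> `|g x - g y| <= e.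
Proof.
move=> gc e0.
have : compact `[0 : R, 1]%classic by exact: segment_compact.
move=> /compact_near_coveringP cover.
have [x /= _|N _ NP] := cover nat \oo
  (fun n x => forall y, `|x - y| < n.+1%:R^-1 -> `|g x - g y| <= e) _; last first.
  exists N => x y x01; apply: (NP N (leqnn N)).
  by rewrite /= in_itv.
have /cvgrPdist_lt/(_ (e / 2)) := gc x; rewrite divr_gt0// => /(_ isT).
move=> /nbhs_ballP[r /= r0 rP].
have r20 : 0 < r / 2 by rewrite divr_gt0.
exists (ball x (r / 2), [set n | n.+1%:R^-1 < r / 2]) => /=.
  split; first exact: nbhsx_ballx.
  exists (Num.truncn (r / 2)^-1) => // n /= n0n.
  rewrite invf_plt ?posrE// (lt_le_trans (truncnS_gt _))//.
  by rewrite ler_nat ltnS.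
move=> [x' n] /= [xx' nr] y x'y.
rewrite -ball_normE /= in xx'.
have gx' : `|g x - g x'| < e / 2.
  by apply: rP; rewrite -ball_normE /=; lra.
have gy : `|g x - g y| < e / 2.
  apply: rP; rewrite -ball_normE /=.
  rewrite -[x](subrK x') -addrA (le_lt_trans (ler_normD _ _))//.
  by rewrite (splitr r) ltrD// (lt_trans x'y).
rewrite -[g x'](subrK (g x)) -addrA (le_trans (ler_normD _ _))// distrC.
by rewrite (splitr e) lerD// ltW.
Qed.

Let uniform_dyadic (g : R -> R) e : continuous g -> 0 < e -> exists n : nat,
  forall i x, (i < 2 ^ n)%N -> dyadic n i x -> `|g (i%:R / 2 ^+ n) - g x| <= e.
Proof.
move=> gc e0; have [m mP] := uniform_modulus gc e0.
exists m.+1 => i x i2 /dyadicP/andP[l1 l2]; apply: mP.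
  rewrite divr_ge0//= ler_pdivrMr// mul1r -natrX ler_nat; exact: ltnW.
rewrite -(ltr_pM2l (pow2_gt0 m.+1)) -{1}(gtr0_norm (pow2_gt0 m.+1)) -normrM.
rewrite mulrBr mulrC divfK ?gt_eqF// distrC ger0_norm ?subr_ge0//.
rewrite (@lt_le_trans _ _ 1)//; first by rewrite ltrBlDl natr1.
rewrite ler_pdivlMr// mul1r -natrX ler_nat; exact: ltnW (ltn_expl _ _).
Qed.

(** Continuous functions are dense, and a continuous function is uniformly close
    on [0, 1[ to the step function with its values at the dyadic points. *)
Lemma step_dense f e : 0 < e -> exists n G, `|f - step n G| <= e.
Proof.
move=> e0; have e20 : 0 < e / 2 by rewrite divr_gt0.
have mI := measurable_itv `[0 : R, 1].
have fI : (@lebesgue_measure R).-integrable `[0, 1] (EFin \o f).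
  have /integrableP[mf fi] := L1_integrable f.
  apply/integrableP; split; first exact: measurable_funTS mf.
  rewrite -unit_integral//.
  by apply: measurableT_comp.
have [|g_ [gc gi gf]] := approximation_continuous_integrable mI _ fI.
  by rewrite [ltLHS]lebesgue_measure_itv/= lte01 oppr0 adde0 ltry.
have [g [gC gI gfe]] : exists g : R -> R, [/\ continuous g,
    (@lebesgue_measure R).-integrable `[0, 1] (EFin \o g) &
    (\int[@lebesgue_measure R]_(x in `[0%R, 1%R]) `|(f x - g x)%:E| < (e / 2)%:E)%E].
  have /fine_cvgP[[N1 _ N1P] /cvgrPdist_lt/(_ _ e20)[N2 _ N2P]] := gf.
  exists (g_ (maxn N1 N2)); split=> //.
  have fin := N1P _ (leq_maxl N1 N2); rewrite /= in fin.
  rewrite -(fineK fin) lte_fin.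
  have := N2P _ (leq_maxr N1 N2); rewrite /= sub0r normrN.
  exact: le_lt_trans (ler_norm _).
have mg : measurable_fun (setT : set (measurableTypeR R)) g.
  exact: continuous_measurable_fun.
have ig : mu.-integrable setT (EFin \o g).
  apply/integrableP; split; first exact/measurable_EFinP.
  rewrite unit_integral//; first by case/integrableP : gI.
  by apply: measurableT_comp => //; exact/measurable_EFinP.
have fg : `|f - L1_of mu g| < e / 2.
  have ih : mu.-integrable setT (EFin \o (fun x => -1 * g x + f x)).
    exact: (integrableD measurableT (integrableZl measurableT (-1) ig) (L1_integrable f)).
  have -> : f - L1_of mu g = L1_of mu (fun x => -1 * g x + f x).
    by rewrite [RHS]L1_of_lin// ?L1_of_id ?scaleN1r 1?addrC//; exact: L1_integrable.
  rewrite [ltLHS]L1_of_norm// -lte_fin /Rintegral fineK.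
    rewrite unit_integral//; last first.
      exact: measurable_int (integrable_norm ih).
    by under eq_integral do rewrite mulN1r addrC.
  exact: integrable_fin_num (integrable_norm ih).
have [n nP] := uniform_dyadic gC e20.
pose G i := g (i%:R / 2 ^+ n); exists n, G.
have gG : `|L1_of mu g - step n G| <= e / 2.
  have [is_ ->] := step_funE n G.
  (* Null outside of [0, 1[, so that the bound holds everywhere. *)
  pose k x := (-1 * step_fun n G x + g x) * \1_(dyadic 0 0) x.
  have -> : L1_of mu g - L1_of mu (step_fun n G) =
      L1_of mu (fun x => -1 * step_fun n G x + g x).
    by rewrite [RHS]L1_of_lin// scaleN1r addrC.
  have ih := integrableD measurableT (integrableZl measurableT (-1) is_) ig.
  have kE x : dyadic 0 0 x -> k x = g x - step_fun n G x.
    by move=> Dx; rewrite /k indicE mem_set// mulr1 mulN1r addrC.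
  have k_small x : `|k x| <= e / 2.
    have [Dx|nDx] := pselect (dyadic 0 0 x); last first.
      by rewrite /k indicE memNset// mulr0 normr0 ltW.
    rewrite kE//; have /dyadicP := Dx; rewrite expr0 mul1r => /andP[x0 x1].
    have y0 : 0 <= 2 ^+ n * x by rewrite mulr_ge0// ltW.
    pose i := Num.truncn (2 ^+ n * x); have xi : dyadic n i x.
      by apply/dyadicP; exact: truncn_itv.
    have i2 : (i < 2 ^ n)%N.
      rewrite -(ltr_nat R) natrX; have /dyadicP/andP[l1 _] := xi.
      by rewrite (le_lt_trans l1)// gtr_pMr.
    have -> : step_fun n G x = G i.
      rewrite /step_fun (bigD1 (Ordinal i2))//= big1 ?addr0 => [|j ji].
        by rewrite indicE mem_set// mulr1.
      rewrite indicE memNset ?mulr0// => xj.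
      have : (dyadic n j `&` dyadic n i) x by split.
      by rewrite dyadic_disjoint.
    by rewrite distrC nP.
  have hk : (fun x => `|-1 * step_fun n G x + g x|) = (fun x => `|k x|) %[ae mu].
    exists (~` dyadic 0 0); split.
    - exact: measurableC (measurable_dyadic 0 0).
    - exact: measure_unit_complement.
    - move=> x /= nx Dx; apply: nx => _.
      by rewrite /k indicE mem_set// mulr1.
  have mh := measurable_int _ ih.
  have mk : measurable_fun setT k.
    apply: measurable_funM; first exact/measurable_EFinP.
    exact: (dyadic1 0 0).1.
  have kb : bounded_measurable (e / 2) k by [].
  rewrite [leLHS]L1_of_norm// (Rintegral_ae _ _ hk); last 2 first.
  - by apply: measurableT_comp => //; exact/measurable_EFinP.
  - exact: measurableT_comp.
  rewrite (@le_trans _ _ (\int[mu]_x (e / 2)))//.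
    apply: le_Rintegral => //.
    - exact: (integrable_norm (bounded_integrable kb)).
    - exact: (bounded_integrable (bounded_measurable_cst (measurableTypeR R) (e / 2))).
  rewrite Rintegral_cst// -[leRHS]mulr1.
  by rewrite [X in _ * fine X]measure_unit_interval.
rewrite -[f](subrK (L1_of mu g)) -addrA (le_trans (ler_normD _ _))//.
by rewrite (splitr e) lerD// ltW.
Qed.

End unit_interval.

(** * Operators defined by dyadic trees, and the Rademacher functions *)

Section bounded_operators.
Context (R : realType).

Lemma bounded_fun_norm_lipschitz (V W : normedModType R) (f : {linear V -> W}) :
  bounded_fun_norm f -> exists2 c : R, 0 < c & forall x, `|f x| <= c * `|x|.
Proof.
move=> /(_ 1)[M MP]; exists (`|M| + 1) => [|x]; first by rewrite ltr_wpDl.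
have [->|x0] := eqVneq x 0; first by rewrite linear0 !normr0 mulr0.
have nx0 : 0 < `|x| by rewrite normr_gt0.
rewrite -ler_pdivrMr// mulrC -[`|x|^-1]ger0_norm ?invr_ge0// -normrZ.
rewrite -linearZ (le_trans (MP _ _))//.
  by rewrite normrZ ger0_norm ?invr_ge0// mulVf ?gt_eqF.
by rewrite (le_trans (ler_norm _))// lerDl.
Qed.

Lemma lipschitz_bounded_fun_norm (V W : normedModType R) (f : V -> W) (c : R) :
  (forall x, `|f x| <= c * `|x|) -> bounded_fun_norm f.
Proof.
move=> fc r; exists (`|c| * r) => x xr; rewrite (le_trans (fc x))//.
rewrite (@le_trans _ _ (`|c| * `|x|))//; first by rewrite ler_wpM2r// ler_norm.
by rewrite ler_wpM2l.
Qed.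

End bounded_operators.

Section tree_operator.
Context (R : realType) (X : completeNormedModType R).
Local Notation L1 := (L1_01 R).
Variables (Y : nat -> nat -> X) (B : R).
Hypothesis Y_bounded : forall n i, (i < 2 ^ n)%N -> `|Y n i| <= B.
Hypothesis Y_mean : forall n i, (i < 2 ^ n)%N ->
  2 *: Y n i = Y n.+1 i.*2 + Y n.+1 i.*2.+1.

Let ind n i : R -> R := \1_(dyadic n i).

Let ind1 n i : bounded_measurable 1 (ind n i : measurableTypeR R -> R).
Proof. exact: bounded_measurable_indic (measurable_dyadic n i). Qed.

Definition tree_partial n (f : L1) : X := \sum_(i < 2 ^ n) pairing f (ind n i) *: Y n i.

Let B0 : 0 <= B. Proof. exact: le_trans (Y_bounded (expn_gt0 2 0)). Qed.

Lemma tree_partial_lin n a f f' :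
  tree_partial n (a *: f + f') = a *: tree_partial n f + tree_partial n f'.
Proof.
rewrite /tree_partial scaler_sumr -big_split; apply: eq_bigr => i _.
by rewrite (pairing_lin _ _ _ (ind1 n i)) scalerDl scalerA.
Qed.

Lemma tree_partial_le n f : `|tree_partial n f| <= B * `|f|.
Proof.
rewrite -(sum_mass_dyadic f n) mulr_sumr (le_trans (ler_norm_sum _ _ _))//.
apply: ler_sum => i _; rewrite normrZ mulrC ler_pM// ?Y_bounded//.
exact: pairing_le_mass (measurable_dyadic n i).
Qed.

Lemma tree_partialB n f f' : tree_partial n (f - f') = tree_partial n f - tree_partial n f'.
Proof. by rewrite addrC -scaleN1r tree_partial_lin scaleN1r addrC. Qed.

Lemma tree_partial0 n : tree_partial n 0 = 0.
Proof. by rewrite -(subrr (0 : L1)) tree_partialB subrr. Qed.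

Lemma tree_partial_cell n m i : (i < 2 ^ n)%N ->
  tree_partial (n + m) (cell R n i) = 2 ^- n *: Y n i.
Proof.
elim: m n i => [|m IH] n i i2.
  rewrite addn0 /tree_partial (bigD1 (Ordinal i2))//= pairing_cell// eqxx.
  rewrite big1 ?addr0// => j ji; rewrite pairing_cell// ifN ?scale0r//.
  by rewrite eq_sym.
rewrite cell_split addnS -addSn -[cell _ _ i.*2]scale1r tree_partial_lin scale1r.
have i22 : (i.*2.+1 < 2 ^ n.+1)%N by rewrite expnS; lia.
rewrite !IH//; last exact: ltnW.
rewrite -scalerDr -Y_mean// scalerA exprS invfM mulrAC mulVf ?mul1r//.
Qed.

Lemma tree_partial_step n m G :
  tree_partial (n + m) (step n G) = \sum_(i < 2 ^ n) (G i * 2 ^- n) *: Y n i.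
Proof.
have addE : {morph tree_partial (n + m) : f f' / f + f'}.
  by move=> f f'; rewrite -[f]scale1r tree_partial_lin !scale1r.
rewrite /step (big_morph _ addE (tree_partial0 _)); apply: eq_bigr => i _.
rewrite -[_ *: cell _ _ _]addr0 tree_partial_lin tree_partial0 addr0.
by rewrite tree_partial_cell// scalerA.
Qed.

Lemma tree_partial_cvg f : exists l : X, tree_partial n f @[n --> \oo] --> l.
Proof.
suff /cvg_ex[l fl] : cvgn (tree_partial ^~ f) by exists l.
apply: cauchy_cvg; apply/cauchyP => e e0.
have c0 : 0 < 2 * B + 1 by rewrite ltr_wpDl// mulr_ge0.
have [n [G fG]] := step_dense f (divr_gt0 (divr_gt0 e0 (ltr0Sn _ 1)) c0).
exists (tree_partial n f); exists n => // m /= nm; rewrite -ball_normE /=.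
have -> : tree_partial n f - tree_partial m f =
    tree_partial n (f - step n G) - tree_partial m (f - step n G).
  have stepE k : (n <= k)%N ->
      tree_partial k (step n G) = \sum_(i < 2 ^ n) (G i * 2 ^- n) *: Y n i.
    by move=> nk; rewrite -(subnKC nk) tree_partial_step.
  by rewrite !tree_partialB !stepE// opprB addrA subrK.
rewrite (le_lt_trans (ler_normB _ _))//.
have := tree_partial_le n (f - step n G); have := tree_partial_le m (f - step n G).
have : (2 * B + 1) * `|f - step n G| <= e / 2 by rewrite mulrC -ler_pdivlMr.
have := normr_ge0 (f - step n G).
lra.
Qed.

(** A bounded dyadic tree in a Banach space defines an operator on L_1: the
    partial sums are martingale averages, eventually constant on dyadic step
    functions, which are dense. *)
Lemma tree_operator : exists V : {linear L1 -> X},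
  (forall f, `|V f| <= B * `|f|) /\
  forall n i, (i < 2 ^ n)%N -> V (cell R n i) = 2 ^- n *: Y n i.
Proof.
have [V VP] := choice tree_partial_cvg.
have V_lin : linear V.
  move=> a f f'; apply: (cvg_unique _ (VP _)) => //.
  rewrite (_ : tree_partial ^~ _ = fun n => a *: tree_partial n f + tree_partial n f').
    by apply: cvgD (VP f'); apply: cvgZl_tmp; exact: VP.
  by apply/funext => n; rewrite tree_partial_lin.
pose lV := GRing.isLinear.Build _ _ _ _ V V_lin.
exists (HB.pack V lV : {linear L1 -> X}); split=> [f|n i i2].
  apply/ler_addgt0Pr => e e0.
  have /cvgrPdist_lt/(_ e e0)[n _ nP] := VP f.
  have /= := nP n (leqnn n); have := tree_partial_le n f.
  have := ler_normD (V f - tree_partial n f) (tree_partial n f); rewrite subrK.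
  lra.
apply: (cvg_unique _ (VP _)) => //; apply: cvg_near_cst.
exists n => // m /= nm; rewrite -(subnKC nm); exact: tree_partial_cell.
Qed.

End tree_operator.

Section rademacher.
Context (R : realType).
Local Notation L1 := (L1_01 R).

Definition rademacher n : L1 :=
  \sum_(i < 2 ^ n) (cell R n.+1 i.*2 - cell R n.+1 i.*2.+1).

Lemma rademacher_step n : rademacher n = step n.+1 (fun i => (-1) ^+ odd i).
Proof.
rewrite /step (sum_double (fun i => (-1) ^+ odd i *: cell R n.+1 i)).
apply: eq_bigr => i _; rewrite /= odd_double.
by rewrite scale1r scaleN1r.
Qed.

Section bessel.
Variables (phi : {linear L1 -> R^o}) (c : R).
Hypotheses (c0 : 0 < c) (phi_le : forall f, `|phi f| <= c * `|f|).

(** The values on the dyadic intervals of rank N of the sum of the first N terms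
    [phi (rademacher n) *: rademacher n]. *)
Fixpoint walk N (i : nat) : R :=
  if N is M.+1 then walk M i./2 + (-1) ^+ odd i * phi (rademacher M) else 0.

Let walk_step N : step N (walk N) = \sum_(n < N) phi (rademacher n) *: rademacher n.
Proof.
elim: N => [|N IH].
  by rewrite big_ord0 /step big1// => i _; rewrite scale0r.
rewrite big_ord_recr/= -IH (step_refine N (walk N)) rademacher_step /step scaler_sumr -big_split.
by apply: eq_bigr => i _; rewrite /= scalerA -scalerDl [X in _ + X]mulrC.
Qed.

Let walk_square N : \sum_(i < 2 ^ N) walk N i ^+ 2 =
  2 ^+ N * \sum_(n < N) phi (rademacher n) ^+ 2.
Proof.
elim: N => [|N IH].
  by rewrite !big_ord0 mulr0 big1// => i _; rewrite expr0n.
rewrite (sum_double (fun i => walk N.+1 i ^+ 2)) big_ord_recr/= mulrDr.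
rewrite {1}exprS -mulrA -IH mulr_sumr.
have -> : 2 ^+ N.+1 * phi (rademacher N) ^+ 2 =
    \sum_(i < 2 ^ N) 2 * phi (rademacher N) ^+ 2 :> R.
  rewrite sumr_const card_ord -[RHS]mulr_natl natrX exprS; ring.
rewrite -big_split; apply: eq_bigr => i _.
rewrite /= odd_double/= doubleK uphalf_double.
ring.
Qed.

(** Let Q be the left-hand side, and g the sum of the
    [phi (rademacher n) *: rademacher n].  Then [Q = phi g] is at most c times the
    L_1 norm of g, while the square of the L_2 norm of g is Q.  The elementary
    bound [c |g| <= c ^ 2 / 2 + g ^ 2 / 2] gives [Q <= c ^ 2 / 2 + Q / 2]. *)
Lemma rademacher_bessel N : \sum_(n < N) phi (rademacher n) ^+ 2 <= c ^+ 2.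
Proof.
set Q := \sum_(n < N) _.
have QE : Q = phi (step N (walk N)).
  by rewrite walk_step linear_sum; apply: eq_bigr => n _; rewrite functionalZ expr2.
have p20 : 0 < 2 ^- N :> R by rewrite invr_gt0 exprn_gt0.
have le1 : Q <= c * (2 ^- N * \sum_(i < 2 ^ N) `|walk N i|).
  rewrite QE (le_trans (ler_norm _))// (le_trans (phi_le _))// ler_wpM2l ?(ltW c0)//.
  exact: step_norm.
have le2 : c * \sum_(i < 2 ^ N) `|walk N i| <=
    \sum_(i < 2 ^ N) (c ^+ 2 / 2 + walk N i ^+ 2 / 2).
  rewrite mulr_sumr; apply: ler_sum => i _.
  have := sqr_ge0 (c - `|walk N i|); rewrite sqrrB real_normK ?num_real//; lra.
rewrite big_split/= sumr_const card_ord -mulr_suml walk_square -/Q in le2.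
have : Q <= c ^+ 2 / 2 + Q / 2.
  rewrite (le_trans le1)// mulrCA -(ler_pM2l (exprn_gt0 N (ltr0Sn R 1))).
  rewrite mulVKf ?gt_eqF ?exprn_gt0// (le_trans le2)//.
  by rewrite -[X in X + _]mulr_natl natrX mulrDr [X in _ <= _ + X]mulrA.
lra.
Qed.

Lemma rademacher_functional_cvg : phi (rademacher n) @[n --> \oo] --> 0.
Proof.
have cs : cvgn (series (fun n => phi (rademacher n) ^+ 2)).
  apply: nondecreasing_is_cvgn.
    apply/nondecreasing_seqP => n; rewrite seriesSr.
    by rewrite lerDl sqr_ge0.
  exists (c ^+ 2) => _ [n _ <-]; rewrite /series/= big_mkord.
  exact: rademacher_bessel.
have := cvg_series_cvg_0 cs => /cvgrPdist_lt H; apply/cvgrPdist_lt => e e0.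
have := H (e ^+ 2); rewrite exprn_gt0// => /(_ isT); apply: filterS => n /=.
rewrite !sub0r !normrN normrX => lt2.
by rewrite -(@ltr_pXn2r _ 2)// nnegrE ltW.
Qed.

End bessel.

Lemma rademacher_weakly_null : weakly_cvg rademacher 0.
Proof.
move=> phi /bounded_fun_norm_lipschitz[c c0 phic]; rewrite linear0.
exact: rademacher_functional_cvg c0 phic.
Qed.

(** The Rademacher functions are weakly null, so their images cannot converge
    to a limit of positive norm. *)
Lemma rademacher_not_CCP (W : normedModType R) (V : {linear L1 -> W}) (e : R) :
  bounded_fun_norm V -> 0 < e -> (forall n, e <= `|V (rademacher n)|) -> ~ CCP W.
Proof.
move=> Vb e0 Ve ccp.
have /cvg_ex[l Vl] := ccp V Vb _ _ rademacher_weakly_null.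
have [phi [phi1 phil]] := Hahn_Banach_norming l.
have [c c0 Vc] := bounded_fun_norm_lipschitz Vb.
have phiV f : `|(phi \o V) f| <= c * `|f| by rewrite (le_trans (phi1 _)).
have /cvgrPdist_lt phiV0 := rademacher_functional_cvg c0 phiV.
have e4 : 0 < e / 4 by rewrite divr_gt0.
have /cvgrPdist_lt/(_ _ e4)[n1 _ n1P] := Vl.
have [n2 _ n2P] := phiV0 _ e4.
set n := maxn n1 n2.
have /= le1 := n1P n (leq_maxl _ _).
have /= := n2P n (leq_maxr _ _); rewrite sub0r normrN => le2.
have := phi1 (l - V (rademacher n)); rewrite linearB/= phil => le3.
have := Ve n.
have := ler_normB (`|l| - phi (V (rademacher n))) (- phi (V (rademacher n))).
rewrite opprK subrK normrN normr_id.
have := ler_normB l (l - V (rademacher n)); rewrite opprB addrC subrK.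
move: le1 le2 le3; rewrite /=; lra.
Qed.

End rademacher.

(** * Bounded functions on which an operator is large *)

Section selection.
Context (R : realType).
Local Notation mu :=
  (mrestr (@lebesgue_measure R) (measurable_itv `[0%R, 1%R])).
Local Notation L1 := (L1_01 R).
Local Notation bounded_by c h :=
  (@bounded_measurable _ (measurableTypeR R) R c h).

Definition truncate (K : R) (f : L1) : R -> R :=
  fun x => (f : R -> R) x * \1_[set x | `|(f : R -> R) x| <= K] x.

Let measurable_le (f : L1) (K : R) :
  measurable ([set x | `|(f : R -> R) x| <= K] : set (measurableTypeR R)).
Proof.
have mf : measurable_fun setT (fun x : measurableTypeR R => `|(f : R -> R) x|).
  by apply: measurableT_comp => //; exact: L1_measurable.
have := mf measurableT _ (measurable_itv `]-oo, K]).
by rewrite setTI; congr measurable; apply/seteqP; split=> x /=; rewrite in_itv.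
Qed.

Lemma bounded_truncate K (f : L1) : 0 <= K -> bounded_by K (truncate K f).
Proof.
move=> K0; split=> [|x].
  by apply: measurable_funM; [exact: L1_measurable|exact: measurable_indic].
rewrite /truncate indicE; have [fx|fx] := pselect (`|(f : R -> R) x| <= K).
  by rewrite mem_set// mulr1.
by rewrite memNset// mulr0 normr0.
Qed.

Lemma truncate_dist K (f : L1) : 0 <= K ->
  `|f - L1_of mu (truncate K f)| = mass f (~` [set x | `|(f : R -> R) x| <= K]).
Proof.
move=> K0; have iK := bounded_integrable (bounded_truncate f K0).
have -> : f - L1_of mu (truncate K f) =
    L1_of mu (fun x => -1 * truncate K f x + (f : R -> R) x).
  by rewrite [RHS]L1_of_lin ?L1_of_id ?scaleN1r 1?addrC//; exact: L1_integrable.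
rewrite [LHS]L1_of_norm; last first.
  exact: (integrableD measurableT (integrableZl measurableT (-1) iK) (L1_integrable f)).
rewrite mass_indic; apply: eq_Rintegral => x _.
rewrite /truncate !indicE mulN1r in_setC.
by case: (x \in _); rewrite /= ?mulr1 ?mulr0 ?addNr ?normr0 ?oppr0 ?add0r.
Qed.

Lemma markov_L1 K (f : L1) : 0 < K ->
  (mu (~` [set x | (`|(f : R -> R) x| <= K)%R]) <= (`|f| / K)%:E)%E.
Proof.
move=> K0; have mC := measurableC (measurable_le f K).
have muC : (mu (~` [set x | (`|(f : R -> R) x| <= K)%R]) \is a fin_num)%E.
  have le1 : (mu (~` [set x | (`|(f : R -> R) x| <= K)%R]) <= 1)%E.
    by rewrite -[leRHS](measure_unit_interval R); apply: le_measure; rewrite ?inE.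
  by rewrite ge0_fin_numE ?measure_ge0// (le_lt_trans le1)// ltry.
rewrite -(fineK muC) lee_fin ler_pdivlMr// mulrC.
rewrite (le_trans _ (mass_le_norm f mC))//.
rewrite -(Rintegral_cst _ mC); apply: le_Rintegral => //.
- apply: (integrableS measurableT) => //.
  exact: bounded_integrable (bounded_measurable_cst (measurableTypeR R) K).
- apply: (integrableS measurableT) => //; exact: (integrable_norm (L1_integrable f)).
- by move=> x /= /negP; rewrite -ltNge => /ltW.
Qed.

(** Dunford-Pettis: a weakly null sequence of L_1 is, up to small errors,
    bounded in L_infty.  Equi-continuity of the masses bounds the norms, since
    the unit interval is covered by finitely many small dyadic intervals, and
    then controls the truncation errors, through Markov's inequality. *)
Lemma weakly_null_truncation (u : nat -> L1) e :
  (forall c g, bounded_by c g -> pairing (u n) g @[n --> \oo] --> 0) ->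
  0 < e -> exists2 K : R, 0 < K & forall n, `|u n - L1_of mu (truncate K (u n))| <= e.
Proof.
move=> u0 e0; have [r r0 rP] := weakly_null_equi_continuous u0 e0.
have [N Nr] : exists N, 2 ^- N < r.
  exists (Num.truncn r^-1).+1.
  rewrite invf_plt ?posrE ?exprn_gt0// (lt_trans (truncnS_gt _))//.
  by rewrite -natrX ltr_nat ltn_expl.
have u_le n : `|u n| <= 2 ^+ N * e.
  rewrite -(sum_mass_dyadic (u n) N).
  rewrite (@le_trans _ _ (\sum_(i < 2 ^ N) e))//.
    apply: ler_sum => i _; apply: rP; first exact: measurable_dyadic.
    by rewrite [ltLHS]measure_dyadic// lte_fin.
  by rewrite sumr_const card_ord -[leLHS]mulr_natl natrX.
pose K := 2 ^+ N * e / r + 1.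
have K0 : 0 < K by rewrite ltr_wpDl// divr_ge0 ?(ltW r0)// mulr_ge0 ?(ltW e0)// exprn_ge0.
exists K => // n; rewrite truncate_dist ?(ltW K0)//; apply: rP.
  exact: measurableC (measurable_le _ _).
apply: le_lt_trans (markov_L1 _ K0) _; rewrite lte_fin ltr_pdivrMr//.
rewrite (le_lt_trans (u_le n))// /K mulrDr mulr1 [r * _]mulrC divfK ?gt_eqF//.
by rewrite ltrDl.
Qed.

(** Linear and bounded for the supremum norm, on bounded measurable functions. *)
Definition sup_functional (theta : (R -> R) -> R) :=
  (forall a c c' h h', bounded_by c h -> bounded_by c' h' ->
    theta (fun x => a * h x + h' x) = a * theta h + theta h') /\
  exists C, forall h, bounded_by 1 h -> `|theta h| <= C.

Section separation.
Variables (X : normedModType R) (T : {linear L1 -> X}) (c : R).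
Hypotheses (c0 : 0 < c) (T_le : forall f, `|T f| <= c * `|f|).
Variables (u : nat -> L1) (l : L1) (d : R).
Hypotheses (ul : weakly_cvg u l) (d0 : 0 < d).
Hypothesis Tu : forall N, exists2 n, (N <= n)%N & d <= `|T (u n - l)|.

(** The images of the [u n - l] are bounded below and weakly null: a later one is
    nearly annihilated by functionals norming the finitely many chosen so far,
    and therefore far from these. *)
Let separated m : exists s : nat -> nat,
  (forall i, (i < m)%N -> d <= `|T (u (s i) - l)|) /\
  forall i j, (i < j < m)%N -> d / 2 <= `|T (u (s i) - l) - T (u (s j) - l)|.
Proof.
elim: m => [|m [s [s1 s2]]]; first by exists (fun=> 0%N); split=> // i j; rewrite ltn0 andbF.
have [phi phiP] := choice (fun i => Hahn_Banach_norming (T (u (s i) - l))).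
have [N NP] : exists N, forall i n, (i < m)%N -> (N <= n)%N ->
    `|phi i (T (u n - l))| <= d / 2.
  elim: (m) => [|k [N NP]]; first by exists 0%N.
  have phiTb : bounded_fun_norm (phi k \o T).
    apply: (@lipschitz_bounded_fun_norm _ _ _ _ c) => f.
    by rewrite (le_trans ((phiP k).1 _)).
  have /cvgrPdist_lt/(_ (d / 2)) := ul phiTb; rewrite divr_gt0// => /(_ isT)[M _ MP].
  exists (maxn N M) => i n; rewrite ltnS leq_eqVlt geq_max => /orP[/eqP ->|ik] /andP[Nn Mn].
    by have /= := MP n Mn; rewrite distrC -linearB -linearB => /ltW.
  exact: NP.
have [n Nn dn] := Tu N.
exists (fun i => if i == m then n else s i); split=> [i|i j].
  rewrite ltnS leq_eqVlt; case: eqP => //= _; exact: s1.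
case/andP => ij; rewrite ltnS leq_eqVlt => jm.
have im : (i < m)%N by case/orP: jm => [/eqP <-//|]; exact: ltn_trans.
rewrite (ltn_eqF im); case/orP: jm => [/eqP jm|jm]; last first.
  by rewrite (ltn_eqF jm) s2// ij.
rewrite jm eqxx; have [phi1 phiE] := phiP i.
have := phi1 (T (u (s i) - l) - T (u n - l)); rewrite linearB phiE.
have := NP i n im Nn; have := s1 i im.
have := ler_norm (`|T (u (s i) - l)| - phi i (T (u n - l))).
have := ler_norm (phi i (T (u n - l))).
rewrite /=; lra.
Qed.

(** Truncations of the separated sequence are still separated, and bounded.
    By the pigeonhole principle two of them have almost the same values under
    any finite family of functionals: their normalized difference is nearly
    annihilated by all of these, and has an image bounded away from 0. *)
Lemma operator_large_on_small_functions : exists2 delta : R, 0 < delta &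
  forall (I : finType) (theta : I -> (R -> R) -> R) (eta : R),
  (forall i, sup_functional (theta i)) -> 0 < eta -> exists f,
  [/\ bounded_by 1 f, delta <= `|T (L1_of mu f)| & forall i, `|theta i f| <= eta].
Proof.
have uP g b : bounded_by b g -> pairing (u n - l) g @[n --> \oo] --> 0.
  exact: weakly_cvg_pairing ul.
have e0 : 0 < d / (8 * c) by rewrite divr_gt0// mulr_gt0.
have [K K0 KP] := weakly_null_truncation (fun b g => @uP g b) e0.
exists (d / (8 * K)) => [|I theta eta theta_sup eta0].
  by rewrite divr_gt0// mulr_gt0.
pose h n := truncate K (u n - l).
have hK n : bounded_by K (h n) by exact/bounded_truncate/ltW.
have [C CP] := choice (fun i => (theta_sup i).2).
pose C' := \sum_i `|C i| + 1.
have C'0 : 0 < C' by rewrite ltr_wpDl// sumr_ge0.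
have thetaC i f : bounded_by 1 f -> `|theta i f| <= C'.
  move=> f1; rewrite (le_trans (CP i f f1))// (le_trans (ler_norm _))//.
  by rewrite /C' (bigD1 i)//= -addrA lerDl addr_ge0// sumr_ge0.
have [N [cell [val gridP]]] :=
  unit_interval_grid R (ltn0Sn (Num.truncn (2 * C' / eta))).
have K20 : 0 < 2 * K by rewrite mulr_gt0.
pose k n x := (2 * K)^-1 * h n x.
have k1 n : bounded_by 2^-1 (k n).
  split=> [|x]; first by apply: measurable_funM => //; exact: (hK n).1.
  rewrite normrM normfV (gtr0_norm K20) mulrC ler_pdivrMr// mulrA mulVf ?mul1r//.
  exact: (hK n).2.
have k1' n : bounded_by 1 (k n).
  by split=> [|x]; [exact: (k1 n).1|rewrite (le_trans ((k1 n).2 x))// invf_le1// ler1n].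
pose code n : {ffun I -> 'I_N} := [ffun i => cell (theta i (k n) / C')].
have [s [_ s2]] := separated (#|{ffun I -> 'I_N}|).+1.
have [i [j [ij codeE]]] : exists i j : 'I_(#|{ffun I -> 'I_N}|).+1,
    (i < j)%N /\ code (s i) = code (s j).
  have : ~ injective (fun i : 'I_(#|{ffun I -> 'I_N}|).+1 => code (s i)).
    by move=> /leq_card; rewrite card_ord ltnn.
  move=> ninj; apply: contrapT => H; apply: ninj => i j codeE; apply/val_inj.
  have [ij|ji|//] := ltngtP i j; case: H.
  - by exists i, j.
  - by exists j, i.
exists (fun x => -1 * k (s j) x + k (s i) x); split.
- split=> [|x].
    apply: measurable_funD; last exact: (k1 _).1.
    by apply: measurable_funM => //; exact: (k1 _).1.
  rewrite (le_trans (ler_normD _ _))// mulN1r normrN.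
  by have := (k1 (s i)).2 x; have := (k1 (s j)).2 x; lra.
- rewrite L1_of_lin; try exact: bounded_integrable (k1 _).
  rewrite !L1_ofZ; try exact: bounded_integrable (hK _).
  rewrite scaleN1r addrC -scalerBr linearZ/= normrZ normfV (gtr0_norm K20).
  have kK n : `|T (u n - l) - T (L1_of mu (h n))| <= d / 8.
    rewrite -linearB (le_trans (T_le _))// mulrC -ler_pdivlMr//.
    by rewrite (le_trans (KP n))// invfM mulrA.
  rewrite [leRHS]mulrC ler_pdivlMr// linearB.
  have -> : d / (8 * K) * (2 * K) = d / 4 by field; rewrite gt_eqF.
  have := s2 i j; rewrite ij ltn_ord => /(_ isT).
  set a := T (u (s i) - l); set b := T (u (s j) - l).
  have := kK (s i); have := kK (s j); rewrite -/a -/b.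
  set a' := T (L1_of mu (h (s i))); set b' := T (L1_of mu (h (s j))) => bb' aa' ab.
  have := ler_normD (a - a') (a' - b'); rewrite addrA subrK.
  have := ler_normD (a - b') (b' - b); rewrite addrA subrK (distrC b' b).
  lra.
- move=> q; have [theta_lin _] := theta_sup q.
  rewrite (theta_lin _ _ _ _ _ (k1' _) (k1' _)) mulN1r.
  have th1 n : `|theta q (k n) / C'| <= 1.
    by rewrite normrM normfV (gtr0_norm C'0) ler_pdivrMr// mul1r thetaC.
  have := gridP _ (th1 (s i)); have := gridP _ (th1 (s j)).
  have -> : cell (theta q (k (s i)) / C') = cell (theta q (k (s j)) / C').
    by have /ffunP/(_ q) := codeE; rewrite !ffunE.
  set z := val _; set n0 := (Num.truncn _).+1 => g1 g2.
  have nn0 : 0 < n0%:R :> R by rewrite ltr0n.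
  have le1 : `|theta q (k (s i)) / C' - theta q (k (s j)) / C'| <= n0%:R^-1 + n0%:R^-1.
    rewrite -[theta q (k (s i)) / C'](subrK z) -addrA (le_trans (ler_normD _ _))//.
    by rewrite (distrC z) lerD.
  have : C' * (n0%:R^-1 + n0%:R^-1) <= eta.
    rewrite (_ : C' * _ = 2 * C' / n0%:R); last by field; rewrite gt_eqF.
    by rewrite ler_pdivrMr// [leRHS]mulrC -ler_pdivrMr// ltW// truncnS_gt.
  apply: le_trans; rewrite -(ler_pM2l C'0) in le1; apply: le_trans le1.
  rewrite -mulrBl normrM normfV (gtr0_norm C'0) mulrCA mulfV ?gt_eqF// mulr1.
  by rewrite addrC.
Qed.

End separation.

End selection.

(** * The construction by stages *)

Section stages.
Context (R : realType) (X : completeNormedModType R).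
Local Notation mu :=
  (mrestr (@lebesgue_measure R) (measurable_itv `[0%R, 1%R])).
Local Notation L1 := (L1_01 R).
Local Notation bounded_by c h :=
  (@bounded_measurable _ (measurableTypeR R) R c h).
Local Notation cls h := (L1_of mu h).

Variables (T : {linear L1 -> X}) (c delta K : R).
Hypotheses (c0 : 0 < c) (T_le : forall f, `|T f| <= c * `|f|).
Hypotheses (delta0 : 0 < delta) (K0 : 0 < K).
Hypothesis T_large : forall (I : finType) (theta : I -> (R -> R) -> R) (eta : R),
  (forall i, sup_functional (theta i)) -> 0 < eta -> exists f,
  [/\ bounded_by 1 f, delta <= `|T (cls f)| & forall i, `|theta i f| <= eta].
Hypothesis X_blocks : forall (b : nat -> X) d M (B e : R),
  coefficients_bounded b d -> (0 < M)%N -> 0 <= B -> 0 < e <= 1 ->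
  exists (I : finType) (phi : I -> {linear X -> R^o}) (eta : R),
  [/\ 0 < eta, forall i x, `|phi i x| <= `|x| &
  forall v : nat -> X, (forall k, (k < M)%N -> `|v k| <= B) ->
  (forall i k, (k < M)%N -> `|phi i (v k)| <= eta) ->
  exists b' d', [/\ (d < d')%N /\ (forall i, (i < d)%N -> b' i = b i),
    coefficients_bounded b' d',
    forall a, `|combination b' a d| <= (1 + e) * `|combination b' a d'|,
    forall a q, (d <= q <= d')%N ->
      `|combination b' a q| <= K * `|combination b' a d'|
  & forall k, (k < M)%N -> exists a, `|combination b' a d' - v k| <= e]].

(** The [weight i], for [i < 2 ^ rank], are the products of factors [1 + f] and
    [1 - f] over the functions chosen so far.  The [node i] form a level of the
    tree; each is an approximation of the image of [weight i], up to the image of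
    the constant 1, in the span of the first [dim] terms of [vec]. *)
Record stage := Stage { rank : nat; weight : nat -> R -> R; dim : nat;
  vec : nat -> X; node : nat -> X }.

(** The bounds increase with the rank, to absorb the errors of all the steps. *)
Definition weights_ok (s : stage) := let n := rank s in
  (forall i, (i < 2 ^ n)%N -> exists c', bounded_by c' (weight s i)) /\
  (forall i, (i < 2 ^ n)%N -> [/\ forall x, 0 <= weight s i x,
    Rintegral mu setT (weight s i) <= 2 - 2 ^- n
    & `|node s i - T (cls (weight s i))| <= c + 1 - 2 ^- n]) /\
  forall x, \sum_(i < 2 ^ n) weight s i x = 2 ^+ n.

Definition nodes_ok (s : stage) := coefficients_bounded (vec s) (dim s) /\
  forall i, (i < 2 ^ rank s)%N -> exists a, node s i = combination (vec s) a (dim s).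

Definition next_stage (s s' : stage) :=
  [/\ rank s' = (rank s).+1,
      (dim s < dim s')%N /\ (forall i, (i < dim s)%N -> vec s' i = vec s i),
      forall a, `|combination (vec s') a (dim s)| <=
        (1 + 2 ^- (rank s).+2) * `|combination (vec s') a (dim s')|,
      forall a q, (dim s <= q <= dim s')%N ->
        `|combination (vec s') a q| <= K * `|combination (vec s') a (dim s')|
    & (forall i, 2 *: node s i = node s' i.*2 + node s' i.*2.+1) /\
      delta / 2 <= `|2 ^- (rank s).+1 *:
        \sum_(i < 2 ^ rank s) (node s' i.*2 - node s' i.*2.+1)|].

Let bi := bounded_integrable.

Lemma cls_mul_norm (rho f : R -> R) c' : bounded_by c' rho -> bounded_by 1 f ->
  (forall x, 0 <= rho x) ->
  `|cls (fun x => rho x * f x)| <= Rintegral mu setT rho.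
Proof.
move=> rb fb rho0; have rf := bi (bounded_measurableM rb fb).
rewrite [leLHS]L1_of_norm//; apply: le_Rintegral => //.
- exact: (integrable_norm rf).
- exact: bi rb.
- by move=> x _; rewrite normrM (ger0_norm (rho0 x)) ler_piMr//; exact: fb.2.
Qed.

Lemma sup_functional_operator (phi : {linear X -> R^o}) (rho : R -> R) c' :
  bounded_by c' rho -> (forall x, 0 <= rho x) -> (forall x, `|phi x| <= `|x|) ->
  sup_functional (fun h => phi (T (cls (fun x => rho x * h x)))).
Proof.
move=> rb rho0 phi1; split=> [a b b' h h' hb hb'|].
  have -> : (fun x => rho x * (a * h x + h' x)) =
      (fun x => a * (rho x * h x) + rho x * h' x).
    by apply/funext => x; ring.
  rewrite L1_of_lin; [|exact: bi (bounded_measurableM rb hb)|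
    exact: bi (bounded_measurableM rb hb')].
  by rewrite !linearD !linearZ.
exists (c * Rintegral mu setT rho) => h hb.
rewrite (le_trans (phi1 _))// (le_trans (T_le _))// ler_pM2l//.
exact: cls_mul_norm rb hb rho0.
Qed.

Lemma sup_functional_integral (rho : R -> R) c' : bounded_by c' rho ->
  (forall x, 0 <= rho x) ->
  sup_functional (fun h => Rintegral mu setT (fun x => rho x * h x)).
Proof.
move=> rb rho0; split=> [a b b' h h' hb hb'|].
  have i1 := bi (bounded_measurableM rb hb).
  have i2 := bi (bounded_measurableM rb hb').
  rewrite -RintegralZl// -RintegralD//; last exact: (integrableZl measurableT a i1).
  by apply: eq_Rintegral => x _; ring.
exists (Rintegral mu setT rho) => h hb.
have rh := bi (bounded_measurableM rb hb).
rewrite (le_trans (le_normr_Rintegral _ rh))//; apply: le_Rintegral => //.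
- exact: (integrable_norm rh).
- exact: bi rb.
- by move=> x _; rewrite normrM (ger0_norm (rho0 x)) ler_piMr//; exact: hb.2.
Qed.

Let sgn (i : nat) : R := (-1) ^+ odd i.

Let weights_split (rho : nat -> R -> R) (f : R -> R) n x :
  \sum_(i < 2 ^ n.+1) (rho i./2 x * (1 + sgn i * f x)) =
  2 * \sum_(i < 2 ^ n) rho i x.
Proof.
rewrite (sum_double (fun i => rho i./2 x * (1 + sgn i * f x))) mulr_sumr.
apply: eq_bigr => i _; rewrite /sgn /= odd_double/= doubleK uphalf_double.
ring.
Qed.

Lemma next_weights n (rho : nat -> R -> R) (node y : nat -> X) dim vec dim' vec' f
    (e := 2 ^- n.+2) : 
  let s := Stage n rho dim vec node in
  weights_ok s -> bounded_by 1 f ->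
  (forall i, (i < 2 ^ n)%N ->
    `|Rintegral mu setT (fun x => rho i x * f x)| <= e) ->
  (forall i, (i < 2 ^ n)%N -> `|y i - T (cls (fun x => rho i x * f x))| <= e) ->
  weights_ok (Stage n.+1 (fun i x => rho i./2 x * (1 + sgn i * f x)) dim' vec'
    (fun i => node i./2 + sgn i *: y i./2)).
Proof.
move=> /= [rho_b [rho_ok rho_sum]] fb rhof yT.
have half i : (i < 2 ^ n.+1)%N -> (i./2 < 2 ^ n)%N by rewrite expnS; lia.
have sgn1 i : `|sgn i| = 1 by rewrite /sgn normrX normrN1 expr1n.
have e1 : 2 - 2 ^- n + e <= 2 - 2 ^- n.+1.
  have p0 : 0 < 2 ^- n :> R by rewrite invr_gt0 exprn_gt0.
  by rewrite /e !exprS !invfM; lra.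
split; last split.
- move=> i /half /rho_b[c' rb].
  exists (c' * (`|1| + `|sgn i| * 1)); apply: bounded_measurableM rb _.
  apply: bounded_measurableD; first exact: bounded_measurable_cst.
  exact: bounded_measurableM (bounded_measurable_cst _ _) fb.
- move=> i /half i2 /=; have [rho0 rho_int node_T] := rho_ok _ i2.
  have [c' rb] := rho_b _ i2.
  have rf := bi (bounded_measurableM rb fb).
  have wE : (fun x => rho i./2 x * (1 + sgn i * f x)) =
      (fun x => sgn i * (rho i./2 x * f x) + rho i./2 x).
    by apply/funext => x; ring.
  split.
  + move=> x; apply: mulr_ge0 => //.
    have := fb.2 x; rewrite ler_norml => /andP[f1 f2].
    by rewrite /sgn; case: odd; rewrite ?expr1 ?expr0; lra.
  + rewrite wE RintegralD//; [|exact: (integrableZl measurableT (sgn i) rf)|exact: bi rb].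
    rewrite RintegralZl// addrC (le_trans _ e1)// lerD//.
    by rewrite (le_trans (ler_norm _))// normrM sgn1 mul1r rhof.
  + rewrite wE L1_of_lin//; last exact: bi rb.
    rewrite linearD linearZ/= [_ *: T _ + _]addrC opprD addrACA -scalerBr.
    rewrite (le_trans (ler_normD _ _))// normrZ sgn1 mul1r.
    by rewrite (le_trans (lerD node_T (yT _ i2)))//; lra.
- by move=> x /=; rewrite (weights_split rho f n x) rho_sum exprS.
Qed.

Lemma cls_sum m (h : nat -> R -> R) :
  (forall i, (i < m)%N -> exists c', bounded_by c' (h i)) ->
  cls (fun x => \sum_(i < m) h i x) = \sum_(i < m) cls (h i).
Proof.
move=> hb; suff [_ ->] : (exists c', bounded_by c' (fun x => \sum_(i < m) h i x)) /\
  cls (fun x => \sum_(i < m) h i x) = \sum_(i < m) cls (h i) by [].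
elim: m hb => [|m IH] hb.
  have -> : (fun x => \sum_(i < 0) h i x) = fun=> 0.
    by apply/funext => x; rewrite big_ord0.
  rewrite big_ord0 [X in _ /\ X = _]L1_of0; split=> //; exists 0.
  by split=> // x; rewrite normr0.
have [|[c1 b1] sumE] := IH; first by move=> i im; apply: hb; exact: ltnW.
have [c2 b2] := hb m (ltnSn m).
have -> : (fun x => \sum_(i < m.+1) h i x) =
    (fun x => 1 * h m x + \sum_(i < m) h i x).
  by apply/funext => x; rewrite big_ord_recr/= addrC mul1r.
split.
  exists (`|1| * c2 + c1); apply: bounded_measurableD b1.
  exact: bounded_measurableM (bounded_measurable_cst _ _) b2.
rewrite L1_of_lin; [|exact: bi b2|exact: bi b1].
by rewrite big_ord_recr/= scale1r sumE addrC.
Qed.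

Lemma combination_lin (b : nat -> X) (a a' : nat -> R) k n :
  combination b (fun i => a i + k * a' i) n =
  combination b a n + k *: combination b a' n.
Proof.
rewrite /combination scaler_sumr -big_split; apply: eq_bigr => i _.
by rewrite scalerDl scalerA.
Qed.

(** The function [f] is chosen to have a large image, while its products with the
    weights have small integrals and images nearly annihilated by the functionals
    of the block extension; these images can then be adjoined to the basic
    sequence.  Since the weights average to 1, so do the images of the products
    to the image of [f], whose norm is bounded below. *)
Lemma next_stage_exists s : weights_ok s -> nodes_ok s ->
  exists s', [/\ weights_ok s', nodes_ok s' & next_stage s s'].
Proof.
case: s => n rho d b node wok [/= cb nodeE].
have [rho_b [rho_ok rho_sum]] := wok.
pose e := Num.min (2 ^- n.+2) (delta / 2).
have p0 : 0 < 2 ^- n.+2 :> R by rewrite invr_gt0 exprn_gt0.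
have e0 : 0 < e by rewrite lt_min p0 divr_gt0.
have e2n : e <= 2 ^- n.+2 by rewrite ge_min lexx.
have ed : e <= delta / 2 by rewrite ge_min lexx orbT.
have e1 : 0 < e <= 1.
  by rewrite e0 (le_trans e2n)// invf_le1 ?exprn_gt0// exprn_ege1// ler1n.
have B0 : 0 <= c * 2 by rewrite mulr_ge0// ltW.
have M0 : (0 < 2 ^ n)%N by rewrite expn_gt0.
have [I [phi [eta [eta0 phi1 blocks]]]] := X_blocks cb M0 B0 e1.
pose theta (t : I * 'I_(2 ^ n) + 'I_(2 ^ n)) (h : R -> R) : R := match t with
  | inl (i, k) => phi i (T (cls (fun x => rho k x * h x)))
  | inr k => Rintegral mu setT (fun x => rho k x * h x)
  end.
have theta_sup t : sup_functional (theta t).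
  case: t => [[i k]|k]; have [c' rb] := rho_b k (ltn_ord k);
    have [rho0 _ _] := rho_ok k (ltn_ord k).
  - exact: sup_functional_operator rb rho0 (phi1 i).
  - exact: sup_functional_integral rb rho0.
have ee0 : 0 < Num.min eta e by rewrite lt_min eta0.
have [f [fb Tf theta_f]] := T_large theta_sup ee0.
pose v k := T (cls (fun x => rho k x * f x)).
have vB k : (k < 2 ^ n)%N -> `|v k| <= c * 2.
  move=> k2; have [c' rb] := rho_b k k2; have [rho0 rho_int _] := rho_ok k k2.
  rewrite /v (le_trans (T_le _))// ler_pM2l// (le_trans (cls_mul_norm rb fb rho0))//.
  by rewrite (le_trans rho_int)// gerBl invr_ge0 exprn_ge0.
have phiv i k : (k < 2 ^ n)%N -> `|phi i (v k)| <= eta.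
  move=> k2; have := theta_f (inl (i, Ordinal k2)).
  by move=> /le_trans; apply; rewrite ge_min lexx.
have [b' [d' [[dd' bb'] cb' b'd b'K b'v]]] := blocks v vB phiv.
have exa k : exists ak, (k < 2 ^ n)%N -> `|combination b' ak d' - v k| <= e.
  have [k2|_] := boolP (k < 2 ^ n)%N; last by exists (fun=> 0).
  by have [ak akP] := b'v k k2; exists ak.
have [a aP] := choice exa.
pose y k := combination b' (a k) d'.
have rhof k : (k < 2 ^ n)%N ->
    `|Rintegral mu setT (fun x => rho k x * f x)| <= 2 ^- n.+2.
  move=> k2; have := theta_f (inr (Ordinal k2)) => /le_trans; apply.
  by rewrite (le_trans _ e2n)// ge_min lexx orbT.
exists (Stage n.+1 (fun i x => rho i./2 x * (1 + sgn i * f x)) d' b'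
  (fun i => node i./2 + sgn i *: y i./2)); split.
- apply: (next_weights d' b' wok fb rhof) => k k2.
  exact: le_trans (aP k k2) e2n.
- split=> //= i i2.
  have i22 : (i./2 < 2 ^ n)%N by move: i2; rewrite expnS; clear; lia.
  have [ai aiE] := nodeE _ i22.
  exists (fun j => (j < d)%:R * ai j + sgn i * a i./2 j).
  rewrite combination_lin combination_cut ?(ltnW dd')// aiE; congr (_ + _).
  by apply: eq_bigr => j _; rewrite bb'.
- split=> //=.
  + move=> a0; rewrite (le_trans (b'd a0))// ler_wpM2r// lerD2l//.
  + split=> [i|].
      rewrite /sgn /= odd_double/= doubleK uphalf_double expr1 scaleN1r scale1r.
      by rewrite addrACA subrr addr0 scaler_nat mulr2n.
    have diffE i : (node i.*2./2 + sgn i.*2 *: y i.*2./2) -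
        (node i.*2.+1./2 + sgn i.*2.+1 *: y i.*2.+1./2) = 2 *: y i.
      rewrite /sgn /= odd_double/= doubleK uphalf_double expr1 scaleN1r scale1r.
      by rewrite opprD opprK addrACA subrr add0r scaler_nat mulr2n.
    under eq_bigr do rewrite diffE.
    rewrite -scaler_sumr scalerA exprS invfM mulrAC mulVf// mul1r.
    have -> : \sum_(i < 2 ^ n) y i =
        \sum_(i < 2 ^ n) (y i - v i) + 2 ^+ n *: T (cls f).
      have -> : 2 ^+ n *: T (cls f) = \sum_(i < 2 ^ n) v i.
        rewrite -linearZ -L1_ofZ; last exact: bi fb.
        rewrite /v -linear_sum -(cls_sum (h := fun i x => rho i x * f x)) => [|i i2]; last first.
          have [c' rb] := rho_b i i2; exists (c' * 1); exact: bounded_measurableM rb fb.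
        congr (T (cls _)); apply/funext => x.
        by rewrite -mulr_suml rho_sum.
      by rewrite -big_split; apply: eq_bigr => i _; rewrite /= subrK.
    rewrite scalerDr scalerA mulVf ?gt_eqF ?exprn_gt0// scale1r addrC.
    set z := _ *: \sum_(i < 2 ^ n) _.
    have ze : `|z| <= e.
      rewrite /z normrZ ger0_norm ?invr_ge0 ?exprn_ge0//.
      rewrite -ler_pdivlMl ?invr_gt0 ?exprn_gt0// invrK.
      rewrite (le_trans (ler_norm_sum _ _ _))//.
      rewrite (@le_trans _ _ (\sum_(i < 2 ^ n) e))//.
        by apply: ler_sum => i _; exact: aP.
      by rewrite sumr_const card_ord -[leLHS]mulr_natl natrX.
    by have := ler_normB (T (cls f) + z) z; rewrite addrK; lra.
Qed.

Let stage0 := Stage 0 (fun _ _ => 1) 0 (fun=> 0) (fun=> 0).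

Let stage0_ok : weights_ok stage0 /\ nodes_ok stage0.
Proof.
have b1 := bounded_measurable_cst (measurableTypeR R) (1 : R).
have int1 : Rintegral mu setT (fun=> 1) = 1.
  by rewrite Rintegral_cst// mul1r [X in fine X]measure_unit_interval.
split; last first.
  split=> /=; first by exists 1.
  by move=> i _; exists (fun=> 0); rewrite /combination big_ord0.
split; first by move=> i _; exists `|1|.
split=> [i _|x] /=; last by rewrite big_ord1 expr0.
split=> //; first by rewrite int1 expr0; lra.
rewrite expr0 invr1 addrK sub0r normrN (le_trans (T_le _))// -[leRHS]mulr1 ler_pM2l//.
rewrite [leLHS]L1_of_norm; last exact: bi b1.
by under eq_Rintegral do rewrite normr1; rewrite int1.
Qed.

Lemma stage_sequence : exists s_ : nat -> stage,
  [/\ dim (s_ 0%N) = 0%N, forall k, rank (s_ k) = k, forall k, weights_ok (s_ k),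
     forall k, nodes_ok (s_ k) & forall k, next_stage (s_ k) (s_ k.+1)].
Proof.
pose ok s := weights_ok s /\ nodes_ok s.
have step (s : {s | ok s}) : {s' : {s | ok s} | next_stage (sval s) (sval s')}.
  have [ws ns] := svalP s; apply: cid.
  by have [s' [ws' ns' ss']] := next_stage_exists ws ns; exists (exist ok s' (conj ws' ns')).
have [s_ [s0 sS]] := dependent_choice step (exist ok _ stage0_ok).
exists (fun k => sval (s_ k)); split=> //.
- by rewrite s0.
- by elim=> [|k IH]; [rewrite s0|have [-> _ _ _ _] := sS k; rewrite IH].
- by move=> k; have [] := svalP (s_ k).
- by move=> k; have [] := svalP (s_ k).
Qed.

Section limit.
Variable s_ : nat -> stage.
Hypothesis dim0 : dim (s_ 0%N) = 0%N.
Hypothesis rankE : forall k, rank (s_ k) = k.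
Hypothesis s_weights : forall k, weights_ok (s_ k).
Hypothesis s_nodes : forall k, nodes_ok (s_ k).
Hypothesis s_next : forall k, next_stage (s_ k) (s_ k.+1).

Let D k := dim (s_ k).
Let basis i := vec (s_ i.+1) i.

Let D_lt k : (D k < D k.+1)%N. Proof. by have [_ []] := s_next k. Qed.

Let D_mono k k' : (k <= k')%N -> (D k <= D k')%N.
Proof.
move=> /subnKC <-; elim: (k' - k)%N => [|j IH]; first by rewrite addn0.
by rewrite addnS (leq_trans IH)// ltnW.
Qed.

Let D_ge k : (k <= D k)%N.
Proof. by elim: k => // k IH; exact: leq_ltn_trans IH (D_lt k). Qed.

Let vec_stable k k' i : (k <= k')%N -> (i < D k)%N -> vec (s_ k') i = vec (s_ k) i.
Proof.
move=> /subnKC <- iD; elim: (k' - k)%N => [|j IH]; first by rewrite addn0.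
have [_ [_ vecE] _ _ _] := s_next (k + j)%N; rewrite addnS vecE//.
exact: leq_trans iD (D_mono (leq_addr _ _)).
Qed.

Let basisE k i : (i < D k)%N -> basis i = vec (s_ k) i.
Proof.
move=> iD; have [le|le] := leqP k i.+1; first exact: vec_stable.
by apply/esym/vec_stable; [exact: ltnW|exact: D_ge].
Qed.

Let combinationE k a q : (q <= D k)%N ->
  combination basis a q = combination (vec (s_ k)) a q.
Proof.
move=> qD; apply: eq_bigr => i _; rewrite (@basisE k)//.
exact: leq_trans (ltn_ord i) qD.
Qed.

(** The factors [1 + 2 ^- (j + 2)] have a bounded product, as
    [(2 - 2 ^- j) * (1 + 2 ^- (j + 2)) <= 2 - 2 ^- (j + 1)]. *)
Let block_le a k m : (k <= m)%N ->
  `|combination basis a (D k)| <= 2 * `|combination basis a (D m)|.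
Proof.
move=> km; pose z j := `|combination basis a (D j)|.
have z0 j : 0 <= z j by exact: normr_ge0.
have t0 j : 0 < 2 ^- j :> R by rewrite invr_gt0 exprn_gt0.
have t1 j : 2 ^- j <= 1 :> R by rewrite invf_le1 ?exprn_gt0// exprn_ege1// ler1n.
have zS j : (2 - 2 ^- j) * z j <= (2 - 2 ^- j.+1) * z j.+1.
  have [_ _ le1 _ _] := s_next j.
  have := le1 a; rewrite rankE -!combinationE ?(ltnW (D_lt j))// -/(z j) -/(z j.+1).
  move=> le2; have tj := t0 j; have tj1 := t1 j.
  rewrite (le_trans (ler_wpM2l _ le2)) ?subr_ge0 ?(le_trans tj1) ?ler1n//.
  rewrite mulrA ler_wpM2r// !exprS !invfM.
  set t := (2 ^+ j)^-1 in tj tj1 *.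
  have := mulr_ge0 (ltW tj) (ltW tj); lra.
have zm : (2 - 2 ^- k) * z k <= (2 - 2 ^- m) * z m.
  rewrite -(subnKC km); elim: (m - k)%N => [|j IH]; first by rewrite addn0.
  by rewrite addnS (le_trans IH).
rewrite -/(z k) -/(z m).
have : 0 <= (1 - 2 ^- k) * z k by rewrite mulr_ge0// subr_ge0.
have : 0 <= 2 ^- m * z m by rewrite mulr_ge0// ltW.
lra.
Qed.

Let basis_basic : basic_sequence (K * 2) basis.
Proof.
split=> [i|a p q pq].
  have iD : (i < D i.+1)%N by exact: D_ge.
  have [[c' c'0 low] _] := s_nodes i.+1; apply/negP => /eqP bi0.
  have := low (fun j => (j == i)%:R) i iD.
  rewrite -combinationE// eqxx normr1 mulr1 leNgt => /negP; apply.
  rewrite /combination big1 ?normr0// => j _.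
  by case: eqP => [->|_]; rewrite ?bi0 ?scaler0 ?scale0r.
have [k kP] : exists k, (D k <= p <= D k.+1)%N.
  have [|k kp kmin] := @ex_minnP (fun k => p < D k.+1)%N.
    by exists p; exact: leq_ltn_trans (D_ge p) (D_lt p).
  exists k; rewrite (ltnW kp) andbT; case: k kp kmin => [|k] kp kmin.
    by rewrite /D dim0.
  by rewrite leqNgt; apply/negP => /kmin; rewrite ltnn.
pose a' i := (i < q)%:R * a i.
have -> : combination basis a p = combination basis a' p.
  apply: eq_bigr => i _; rewrite /a' (leq_trans (ltn_ord i) pq) mul1r.
  by [].
pose m := maxn k.+1 q.
have qD : (q <= D m)%N by rewrite (leq_trans (leq_maxr k.+1 q))// D_ge.
rewrite -(combination_cut basis a qD) -/a'.
have [_ _ _ leK _] := s_next k; have := leK a' p kP.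
have /andP[_ pD] := kP.
rewrite -(combinationE a' pD) -(combinationE a' (leqnn (D k.+1))) => /le_trans; apply.
by rewrite -mulrA ler_pM2l// block_le// leq_maxl.
Qed.

Let Y n i := node (s_ n) i.

Let Y_bounded n i : (i < 2 ^ n)%N -> `|Y n i| <= c * 2 + (c + 1).
Proof.
move=> i2; have [wb [wok _]] := s_weights n; rewrite rankE in wb wok.
have [c' rb] := wb i i2; have [rho0 rho_int dist] := wok i i2.
have p0 : 0 < 2 ^- n :> R by rewrite invr_gt0 exprn_gt0.
have Tle : `|T (cls (weight (s_ n) i))| <= c * 2.
  rewrite (le_trans (T_le _))// ler_pM2l// [leLHS]L1_of_norm; last exact: bi rb.
  have intE : Rintegral mu setT (fun x => `|weight (s_ n) i x|) =
      Rintegral mu setT (weight (s_ n) i).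
    by apply: eq_Rintegral => x _; exact: ger0_norm.
  by rewrite intE (le_trans rho_int)// gerBl ltW.
rewrite -[Y n i](subrK (T (cls (weight (s_ n) i)))) (le_trans (ler_normD _ _))//.
by rewrite addrC lerD// (le_trans dist)// gerBl ltW.
Qed.

Let Y_mean n i : (i < 2 ^ n)%N -> 2 *: Y n i = Y n.+1 i.*2 + Y n.+1 i.*2.+1.
Proof. by have [_ _ _ _ [-> _]] := s_next n. Qed.

Let Y_span n i : (i < 2 ^ n)%N -> Y n i \in closed_span basis.
Proof.
move=> i2; have [_ nE] := s_nodes n; rewrite rankE in nE.
have [a aE] := nE i i2; rewrite /Y aE -combinationE//; exact: mem_closed_span.
Qed.

(** The nodes form a bounded dyadic tree in the closed span of the basic sequence;
    the operator that it defines maps the Rademacher functions to the averaged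
    differences of consecutive levels, which are bounded below. *)
Lemma limit_subspace : exists S : submodClosed X,
  [/\ closed [set` S], exists e : nat -> linsub S, schauder_basis e
    & ~ CCP (linsub S)].
Proof.
exists (closed_span basis); split; first exact: closed_closed_span.
  exact: basic_sequence_schauder basis_basic.
have [V [V_le V_cell]] := tree_operator Y_bounded Y_mean.
set B := c * 2 + (c + 1) in V_le.
have B0 : 0 < B by rewrite /B; have := c0; lra.
have V_span f : V f \in closed_span basis.
  have : closure [set` closed_span basis] (V f).
    move=> N /nbhs_ballP[r /= r0 rN].
    have [n [G fG]] := step_dense f (divr_gt0 (divr_gt0 r0 (ltr0Sn _ 1)) B0).
    exists (V (step n G)); split=> /=.
      rewrite linear_sum rpred_sum// => i _; rewrite linearZ V_cell// !rpredZ//.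
      exact: Y_span.
    apply: rN; rewrite -ball_normE /= -linearB (le_lt_trans (V_le _))//.
    rewrite (@le_lt_trans _ _ (r / 2))// ?ltr_pdivrMr ?ltr_pMr ?ltr1n//.
    by rewrite mulrC -ler_pdivlMr.
  by have /closure_id <- := closed_closed_span (b := basis).
pose W f : linsub (closed_span basis) := Sub (V f) (V_span f).
have W_lin : linear W.
  move=> a f f'; apply: val_inj; rewrite linsub_valD linsub_valZ !SubK.
  exact: linearP.
pose lW := GRing.isLinear.Build _ _ _ _ W W_lin.
pose W' : {linear L1 -> linsub (closed_span basis)} := HB.pack W lW.
apply: (@rademacher_not_CCP _ _ W' (delta / 2)).
- by apply: (@lipschitz_bounded_fun_norm _ _ _ _ B) => f; rewrite linsub_normE SubK.
- by rewrite divr_gt0.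
move=> n; rewrite linsub_normE SubK.
have [_ _ _ _ [_ low]] := s_next n; rewrite rankE in low.
rewrite (le_trans low)// le_eqVlt; apply/orP; left; apply/eqP.
congr (`| _ |); rewrite [RHS]linear_sum scaler_sumr; apply: eq_bigr => i _.
have i22 : (i.*2.+1 < 2 ^ n.+1)%N.
  by have := ltn_ord i; rewrite expnS; clear; lia.
by rewrite [RHS]linearB !V_cell// ?(ltnW i22)// -scalerBr.
Qed.

End limit.

End stages.

(** * Subspaces with a basis failing the complete continuity property *)

Lemma operator_not_converging (R : realType) (V W : normedModType R)
    (T : {linear V -> W}) (u : nat -> V) (l : V) : ~ cvgn (T \o u) ->
  exists2 d : R, 0 < d & forall N, exists2 n, (N <= n)%N & d <= `|T (u n - l)|.
Proof.
move=> ncv; apply: contrapT => nd; apply: ncv; apply/cvg_ex; exists (T l).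
apply/cvgrPdist_lt => e e0; apply: contrapT => nN; apply: nd; exists e => // N.
apply: contrapT => nn; apply: nN; exists N => // n /= Nn.
rewrite ltNge; apply/negP => le; apply: nn; exists n => //.
by rewrite linearB distrC.
Qed.

Theorem corollary4 (R : realType) (X : completeNormedModType R)
  (notCCP : ~ CCP X) (notcotype : fails_cotype X) :
  exists Y : submodClosed X,
    [/\ closed [set` Y], exists e : nat -> linsub Y, schauder_basis e
      & ~ CCP (linsub Y)].
Proof.
have [T [Tb [u [l [ul nTu]]]]] : exists T : {linear L1_01 R -> X},
    bounded_fun_norm T /\ exists u l, weakly_cvg u l /\ ~ cvgn (T \o u).
  apply: contrapT => H; apply: notCCP => T Tb u l ul.
  by apply: contrapT => nTu; apply: H; exists T; split=> //; exists u, l.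
have [c c0 T_le] := bounded_fun_norm_lipschitz Tb.
have [d d0 Tu] := operator_not_converging l nTu.
have [delta delta0 T_large] := operator_large_on_small_functions c0 T_le ul d0 Tu.
have [K K0 blocks] := basic_block_extension notcotype.
have [s_ [dim0 rankE ws ns nexts]] := stage_sequence c0 T_le delta0 K0 T_large blocks.
exact (limit_subspace c0 T_le delta0 K0 dim0 rankE ws ns nexts).
Qed.
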